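(* In the setting described in the context, suppose that $U$ is continuously differentiable in $]-\infty,c[$, and let $\nu\in\overline{\mathcal H}_X$ be an optimal randomized strategy. Fix $i\in\{1,\dots,n\}$ such that $\Psi_i$ is continuous in $D_{k_i}\cup\Delta_{k_i}$ and continuously differentiable in $D_{k_i}$, and suppose that: (A1) either the gradient $\nabla\Psi_i:D_{k_i}\to\mathbb R^{k_i}$ can be extended by continuity to the set $\Delta_{k_i}$, or the marginal distribution $\nu_{Z_i}$ is not concentrated at a single point; (A2) there is some $\delta>0$ such that $\mathbb E^\nu U(L_\nu-\delta)>-\infty$. If the marginal distribution $\mu_{X_i}$ is absolutely continuous except possibly for an atom at $x_i=0$ and the strategy prescribed by $\nu$ for the risk $i$ is deterministic (i.e., $Z_i=Z_i(X_i)$ $\nu$-a.s. for a measurable function $Z_i(\cdot)$), then the optimal treaty $Z_i$ satisfies the conditions $$\mathbb E^\nu_{(X_{[i]},Z_{[i]})|X_i}U'(L_\nu)(x_i,Z_i(x_i))\le\sum_{j=1}^{k_i}\frac{\partial\Psi_i}{\partial u_j}\,j\,Z_i(x_i)^{j-1}\,\mathbb E^\nu U'(L_\nu)$$ for $\mu_{X_i}$-a.e. $x_i>0$ such that $Z_i(x_i)<x_i$, and $$\mathbb E^\nu_{(X_{[i]},Z_{[i]})|X_i}U'(L_\nu)(x_i,Z_i(x_i))\ge\sum_{j=1}^{k_i}\frac{\partial\Psi_i}{\partial u_j}\,j\,Z_i(x_i)^{j-1}\,\mathbb E^\nu U'(L_\nu)$$ for $\mu_{X_i}$-a.e. $x_i>0$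 such that $Z_i(x_i)>0$. The partial derivatives $\frac{\partial\Psi_i}{\partial u_j}$ are evaluated at $u=(\mathbb E Z_i(X_i),\mathbb E Z_i(X_i)^2,\dots,\mathbb E Z_i(X_i)^{k_i})$.
   Context: Let $n\ge2$ and let $X=(X_1,\dots,X_n)$ be a random vector with values in $[0,+\infty[^n$, law $\mu_X$ and marginals $\mu_{X_i}$. For an array $x=(x_1,\dots,x_n)$, $x_{[i]}=(x_1,\dots,x_{i-1},x_{i+1},\dots,x_n)$. $\mathcal P$ is the space of Borel probability measures on $\mathbb R^{2n}$ with the topology of weak convergence. Coordinates on $\mathbb R^{2n}$ are written $(x,z)=(x_1,\dots,x_n,z_1,\dots,z_n)$, and $X_i,Z_i$ also denote the coordinate maps; $\mathbb E^\nu\varphi=\int\varphi\,d\nu$; $\nu_{Z_i}$ is the law of $Z_i$ under $\nu$. $\mathcal H_X$ is the set of all $\nu\in\mathcal P$ such that: (i) the marginal of $\nu$ on the $x$-coordinates is $\mu_X$; (ii) $\nu\{(x,z): 0\le z_i\le x_i,\ i=1,\dots,n\}=1$; (iii) for every $i$, under $\nu$ the variable $Z_i$ is conditionally independent of $(X_{[i]},Z_{[i]})$ given $X_i$. $\overline{\mathcal H}_X$ is the closure of $\mathcal H_X$ in $\mathcal P$. Premiums: for $j=1,\dots,n$, $k_j\ge1$ is an integer with $\mathbb E X_j^{k_j}<\infty$, $\Psi_j:[0,+\infty[^{k_j}\to[0,+\infty[$ is continuous, and $P_j(\nu)=\Psi_j(\mathbb E^\nu Z_j,\dots,\mathbb E^\nu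 Z_j^{k_j})$. $c\in\mathbb R$, and $L_\nu(x,z)=c-\sum_{j=1}^n(P_j(\nu)+x_j-z_j)$. $U:\,]-\infty,c]\to\mathbb R$ is concave and nondecreasing; $U'$ is its derivative (left derivative at the endpoint $c$). An optimal randomized strategy is a maximizer of $\rho(\nu)=\mathbb E^\nu U(L_\nu)$ over $\nu\in\overline{\mathcal H}_X$. $D_k=\{u\in\,]0,+\infty[^k:u_1<u_2^{1/2}<\cdots<u_k^{1/k}\}$ and $\Delta_k=\{u\in[0,+\infty[^k:u_1=u_2^{1/2}=\cdots=u_k^{1/k}\}$. If $u\in\Delta_{k_i}$, partial derivatives at $u$ mean the components of the continuous extension of $\nabla\Psi_i$. Convention: $0^0=1$. For a function $\varphi$ on $\mathbb R^{2n}$, $\mathbb E^\nu_{(X_{[i]},Z_{[i]})|X_i}\varphi$ is the function of $(x_i,z_i)$ given by $\int_{\mathbb R^{2n-2}}\varphi(x,z)\,\tilde Q(x_i,d(x_{[i]},z_{[i]}))$, where $\tilde Q$ is a regular conditional law under $\nu$ of $(X_{[i]},Z_{[i]})$ given $X_i$. *)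

(* Defs.v *)
From HB Require Import structures.
From mathcomp Require Import all_boot all_order all_algebra.
From mathcomp Require Import all_classical all_reals all_analysis.

Set Implicit Arguments.
Unset Strict Implicit.
Unset Printing Implicit Defensive.

Import Order.TTheory GRing.Theory Num.Theory.
Import numFieldNormedType.Exports.

Local Open Scope classical_set_scope.
Local Open Scope ring_scope.

(* [T] with its Borel sigma-algebra, as a measurable type. *)
Notation borel T := (g_sigma_algebraType (@open T)).

Lemma continuous_borel_measurable (R : realType) (T : ptopologicalType)
    (f : T -> R) :
  continuous f -> measurable_fun [set: borel T] (f : borel T -> R).
Proof.
move=> /continuousP cf; apply: (measurability _ (measurable_realfun.RGenOpens.measurableE R)).
move=> _ [_ [a [b ->] <-]]; rewrite setTI.
by apply: sub_sigma_algebra; apply: cf; exact: interval_open.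
Qed.

(* The coarsest topology on Borel probability measures making nu |-> \int f dnu
   continuous for every bounded continuous f. *)
Definition weak_probability (R : realType) (T : ptopologicalType) :
    topologicalType :=
  sup_topology (fun f : {f : T -> R | continuous f /\ bounded_fun f} =>
    Topological.class (initial_topology
      (fun nu : probability (borel T) R => \int[nu]_w (projT1 f w)))).

(* Makes a product of pointed topological spaces a [ptopologicalType]. *)
HB.instance Definition _ (T U : ptopologicalType) := Pointed.on (T * U)%type.

Section coordinates.
Variables (R : realType) (n : nat).

(* R^{2n}, points (x, z). *)
Definition space2 : ptopologicalType := ('rV[R]_n * 'rV[R]_n)%type.

(* The range of (x_[i], z_[i]). *)
Definition space2' : ptopologicalType := ('rV[R]_n.-1 * 'rV[R]_n.-1)%type.

Definition component (i : 'I_n) (x : borel 'rV[R]_n) : R := (x : 'rV[R]_n) 0 i.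

Definition xcoord (i : 'I_n) (w : borel space2) : R := (w : space2).1 0 i.

Definition zcoord (i : 'I_n) (w : borel space2) : R := (w : space2).2 0 i.

Lemma measurable_component i : measurable_fun setT (component i).
Proof.
by apply: continuous_borel_measurable => x; exact: coord_continuous.
Qed.

Lemma measurable_xcoord i : measurable_fun setT (xcoord i).
Proof.
apply: (@continuous_borel_measurable _ space2 (fun w : space2 => w.1 0 i)) => w.
apply: (@continuous_comp _ _ _ fst (fun x : 'rV[R]_n => x 0 i)).
  exact: cvg_fst.
exact: coord_continuous.
Qed.

Lemma measurable_zcoord i : measurable_fun setT (zcoord i).
Proof.
apply: (@continuous_borel_measurable _ space2 (fun w : space2 => w.2 0 i)) => w.
apply: (@continuous_comp _ _ _ snd (fun x : 'rV[R]_n => x 0 i)).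
  exact: cvg_snd.
exact: coord_continuous.
Qed.

HB.instance Definition _ i :=
  isMeasurableFun.Build _ _ _ _ (component i) (measurable_component i).
HB.instance Definition _ i :=
  isMeasurableFun.Build _ _ _ _ (xcoord i) (measurable_xcoord i).
HB.instance Definition _ i :=
  isMeasurableFun.Build _ _ _ _ (zcoord i) (measurable_zcoord i).

(* (x, z) |-> (x_[i], z_[i]) *)
Definition others (i : 'I_n) (w : borel space2) : borel space2' :=
  (col' i (w : space2).1, col' i (w : space2).2).

Definition insert (i : 'I_n) (a : R) (y : 'rV[R]_n.-1) : 'rV[R]_n :=
  \row_j (if unlift i j is Some l then y 0 l else a).

(* The inverse of w |-> (x_i, z_i, (x_[i], z_[i])). *)
Definition insert2 (i : 'I_n) (a b : R) (v : borel space2') : borel space2 :=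
  (insert i a (v : space2').1, insert i b (v : space2').2).

End coordinates.

Section conditioning.
Variables (R : realType) (d : measure_display) (T : measurableType d).
Variables (nu : probability T R) (Y : {mfun T >-> R}).

(* [g \o Y] is a version of nu(E | Y). *)
Definition is_cond_prob (E : set T) (g : R -> R) : Prop :=
  measurable_fun setT g /\
  forall C : set R, measurable C ->
    nu (E `&` Y @^-1` C) = (\int[distribution nu Y]_(y in C) (g y)%:E)%E.

Definition cond_indep d1 d2 (T1 : measurableType d1) (T2 : measurableType d2)
    (V : T -> T1) (W : T -> T2) : Prop :=
  forall (A : set T1) (B : set T2), measurable A -> measurable B ->
  exists gA gB : R -> R,
    [/\ is_cond_prob (V @^-1` A) gA,
        is_cond_prob (W @^-1` B) gB &
        is_cond_prob (V @^-1` A `&` W @^-1` B) (gA \* gB)].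

Definition is_regular_cond_law d1 (T1 : measurableType d1) (V : T -> T1)
    (Q : R.-pker R ~> T1) : Prop :=
  forall (C : set R) (B : set T1), measurable C -> measurable B ->
    nu (Y @^-1` C `&` V @^-1` B) = (\int[distribution nu Y]_(y in C) Q y B)%E.

End conditioning.

Section strategies.
Variables (R : realType) (n : nat).

Definition strategies (muX : probability (borel 'rV[R]_n) R) :
    set (weak_probability R (space2 R n)) :=
  [set nu : probability (borel (space2 R n)) R |
    [/\ forall B : set (borel 'rV[R]_n), measurable B ->
          nu [set w | B (w : space2 R n).1] = muX B,
        nu [set w | forall i, 0 <= zcoord i w <= xcoord i w] = 1%E &
        forall i, cond_indep nu (xcoord i) (zcoord i) (@others R n i)]].

Variables (k : 'I_n -> nat) (Psi : forall j, 'rV[R]_(k j) -> R) (c : R).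
Variables (U : R -> R).

Definition premium (nu : probability (borel (space2 R n)) R) (j : 'I_n) : R :=
  Psi (\row_(l < k j) \int[nu]_w (zcoord j w ^+ l.+1)).

Definition payoff (nu : probability (borel (space2 R n)) R)
    (w : borel (space2 R n)) : R :=
  c - \sum_(j < n) (premium nu j + xcoord j w - zcoord j w).

(* E(phi(L)) for a function phi meaningful on ]-oo, c] only. The values of phi
   beyond c are discarded; whenever this is used, L <= c almost surely. *)
Definition expect d (T : measurableType d) (mu : {measure set T -> \bar R})
    (phi : R -> R) (L : T -> R) : \bar R :=
  (\int[mu]_(w in [set w | (L w <= c)%R]) (phi (L w))%:E)%E.

Definition rho (nu : probability (borel (space2 R n)) R) : \bar R :=
  expect nu U (payoff nu).

Definition optimal_randomized_strategy
    (muX : probability (borel 'rV[R]_n) R)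
    (nu : probability (borel (space2 R n)) R) : Prop :=
  closure (strategies muX) nu /\
  forall nu' : probability (borel (space2 R n)) R,
    closure (strategies muX) nu' -> (rho nu' <= rho nu)%E.

(* U' on ]-oo, c], with the left derivative at c. *)
Definition marginal_utility (y : R) : R :=
  if y < c then derive1 U y else lim (h^-1 * (U (c + h) - U c) @[h --> 0^'-]).

End strategies.

Section gradient.
Variables (R : realType) (k : nat).

Definition orthant : set 'rV[R]_k := [set u | forall l, 0 <= u 0 l].

Definition Dset : set 'rV[R]_k :=
  [set u | (forall l, 0 < u 0 l) /\
    forall l m : 'I_k, (l < m)%N ->
      u 0 l `^ (l.+1%:R)^-1 < u 0 m `^ (m.+1%:R)^-1].

Definition Deltaset : set 'rV[R]_k :=
  [set u | (forall l, 0 <= u 0 l) /\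
    forall l m : 'I_k, u 0 l `^ (l.+1%:R)^-1 = u 0 m `^ (m.+1%:R)^-1].

Variable Psi : 'rV[R]_k -> R.

Definition gradient (u : 'rV[R]_k) : 'rV[R]_k :=
  \row_l 'D_(delta_mx 0 l) Psi u.

Definition continuously_differentiable_on_D : Prop :=
  (forall u, Dset u -> differentiable Psi u) /\
  {within Dset, continuous gradient}.

Definition gradient_extends_to_Delta : Prop :=
  exists G : 'rV[R]_k -> 'rV[R]_k,
    {within Dset `|` Deltaset, continuous G} /\
    forall u, Dset u -> G u = gradient u.

(* Off D, the value at u of the continuous extension of the gradient. *)
Definition extended_gradient (u : 'rV[R]_k) : 'rV[R]_k :=
  if `[< Dset u >] then gradient u
  else lim (gradient v @[v --> within Dset (nbhs u)]).

End gradient.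

(* Main.v *)
Require Import Defs.
From HB Require Import structures.
From mathcomp Require Import all_boot all_order all_algebra.
From mathcomp Require Import all_classical all_reals all_analysis.
From mathcomp Require Import measurable_realfun.
From mathcomp Require Import ring lra.

Set Implicit Arguments.
Unset Strict Implicit.
Unset Printing Implicit Defensive.

Import Order.TTheory GRing.Theory Num.Theory.
Import numFieldNormedType.Exports.

Local Open Scope classical_set_scope.
Local Open Scope ring_scope.

(** The idea is to compare [nu] with the strategies obtained by moving the
    treaty of risk [i] alone.  Fix a continuous [h] with values in [[-1, 1]] and,
    for small [s > 0], replace [z_i] by [z_i + s h(x_i)], clamped to [[0, x_i]].
    This map of [R^2n] is continuous, so it acts continuously on laws
    for the weak topology, and it sends strategies to strategies: the new
    treaty is still a function of [(X_i, Z_i)], hence conditionally independent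
    of the other risks given [X_i] ([cond_indep_function], [strategies_replace]).
    It therefore preserves the closure of the set of strategies
    ([closure_pushforward]), and optimality says that the expected utility does
    not increase along the perturbation.

    Differentiating at [s = 0] from the right gives one inequality per [h].
    - The payoff changes by the move of the treaty minus the change of the
      premium.  By concavity, the change of utility is at least [U'] at the
      perturbed payoff times the change of payoff; hypothesis (A2) provides the
      integrable bound for [U'] near [L] that dominated convergence requires
      ([marginal_utility_bound], [first_order_condition]).  Continuity of [U']
      up to the endpoint [c] follows from concavity
      ([marginal_utility_continuous]).
    - The premium is [Psi_i] of the moment vector.  The segment joining the
      moment vectors of two treaties lies, except perhaps for its endpoints, in
      the open set [D], unless both treaties are almost surely equal to the same
      constant: this is Lyapunov's strict inequality for a mixture of the two
      laws ([mixed_moments_in_D]).  Hence the mean value theorem applies along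
      the segment ([premium_increment]) and only the limit of the gradient of
      [Psi_i] inside [D] matters.  Hypothesis (A1) makes that limit exist: the
      moment vector is in [D] if the treaty is not constant, and otherwise it
      lies on [Delta], where the gradient has a continuous extension
      ([gradient_cvg_extended]).

    The rate of the clamped move is [h(x)] where [z < x] if [h >= 0], and
    [h(x)] where [z > 0] if [h <= 0]: the first sign yields the upper
    inequality, the second the lower one.  As [Z_i] is a function of [X_i],
    disintegrating along [Q] ([regular_cond_law_integral]) turns each of them
    into the sign of an integral of [h] against a function of [x_i], and
    continuous functions are numerous enough to recover the sign of that
    function almost everywhere ([ae_le0_continuous_tests]). *)

(** * Concave utilities *)

Section concave_utility.
Variables (R : realType) (c : R) (U : R -> R).
Hypothesis U_concave :
  convex_function (`]-oo, c]%classic : set R^o) (fun y => - U y).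
Hypothesis U_nondecreasing : {in `]-oo, c] &, {homo U : x y / x <= y}}.
Hypothesis U_derivable : {in `]-oo, c[, forall y, derivable U y 1}.
Hypothesis U'_cont : {in `]-oo, c[, continuous (derive1 U)}.

Lemma concave_chord x y z : x < y -> y < z -> z <= c ->
  (z - y) * U x + (y - x) * U z <= (z - x) * U y.
Proof.
move=> xy yz zc; have xz : 0 < z - x by rewrite subr_gt0 (lt_trans xy).
have t01 : 0 <= (z - y) / (z - x) <= 1.
  apply/andP; split; first by apply: divr_ge0; lra.
  by rewrite ler_pdivrMr //; lra.
have := @U_concave (Itv01 (proj1 (andP t01)) (proj2 (andP t01))) x z.
rewrite !inE /= !in_itv /= zc => /(_ _ _).
rewrite (le_trans (ltW xy) (le_trans (ltW yz) zc)) => /(_ erefl erefl).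
rewrite /conv /= /conv /=.
rewrite -![_ *: _]/(_ * _).
have -> : (z - y) / (z - x) * x + (1 - (z - y) / (z - x)) * z = y.
  by field; lra.
move=> /(ler_wpM2l (ltW xz)).
have -> : (z - x) * ((z - y) / (z - x) * - U x +
   (1 - (z - y) / (z - x)) * - U z) = - ((z - y) * U x + (y - x) * U z).
  by field; lra.
by rewrite mulrN lerN2.
Qed.

Local Notation U' := (marginal_utility c U).


(** A one-sided difference quotient of a concave function bounds every chord
    issued from the same point on that side. *)
Lemma concave_tangent_interior a b : a < c -> b <= c ->
  U b - U a <= U' a * (b - a).
Proof.
move=> ac bc; rewrite /marginal_utility ac.
have /U_derivable : a \in `]-oo, c[ by rewrite in_itv.
rewrite /derivable derive1E /derive => dU.
have [ab|ba|->] := ltgtP a b; last by rewrite !subrr mulr0.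
- have ab0 : 0 < b - a by rewrite subr_gt0.
  rewrite -ler_pdivrMr //.
  have dUr := cvg_dnbhs_at_right dU.
  rewrite -(cvg_lim _ dUr) //; apply: limr_ge; first by apply/cvg_ex; eexists; exact: dUr.
  near=> h.
  have h0 : 0 < h by near: h; exact: nbhs_right_gt.
  have hb : h < b - a by near: h; exact: nbhs_right_lt.
  rewrite -![_ *: _]/(_ * _) mulr1.
  have /(_ _ _ bc) := @concave_chord a (h + a) b.
  rewrite (_ : a < h + a); last by lra.
  rewrite (_ : h + a < b); last by lra.
  move=> /(_ erefl erefl) H.
  by rewrite ler_pdivrMr // -mulrA ler_pdivlMl //=; lra.
- have ab0 : b - a < 0 by rewrite subr_lt0.
  rewrite -ler_ndivlMr //.
  have dUr := cvg_dnbhs_at_left dU.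
  rewrite -(cvg_lim _ dUr) //; apply: limr_le; first by apply/cvg_ex; eexists; exact: dUr.
  near=> h.
  have h0 : h < 0 by near: h; exact: nbhs_left_lt.
  have hb : b - a < h by near: h; exact: nbhs_left_gt.
  rewrite -![_ *: _]/(_ * _) mulr1.
  have /(_ _ _ (ltW ac)) := @concave_chord b (h + a) a.
  rewrite (_ : h + a < a); last by lra.
  rewrite (_ : b < h + a); last by lra.
  move=> /(_ erefl erefl) H.
  by rewrite ler_ndivlMr // -mulrA ler_ndivlMl //=; lra.
Unshelve. all: by end_near. Qed.

Local Notation slope h := (h^-1 * (U (c + h) - U c)).

Lemma slope_nonincreasing h k : h < k -> k < 0 -> slope k <= slope h.
Proof.
move=> hk k0.
have := @concave_chord (c + h) (c + k) c.
rewrite (_ : c + h < c + k); last by lra.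
rewrite (_ : c + k < c); last by lra.
move=> /(_ erefl erefl (lexx _)) H.
by rewrite ler_ndivrMl // mulrCA ler_ndivrMl; lra.
Qed.

Lemma slope_ge0 h : h < 0 -> 0 <= slope h.
Proof.
move=> h0; rewrite nmulr_rge0 ?invr_lt0 // subr_le0.
by apply: U_nondecreasing; rewrite ?in_itv /=; lra.
Qed.

Lemma slope_cvg : slope h @[h --> 0^'-] --> U' c.
Proof.
have : cvg (- slope h @[h --> (0 : R)^'-]).
  apply: nondecreasing_at_left_is_cvgr.
    near=> x => u v; rewrite !in_itv /= => /andP[_ u0] /andP[_ v0].
    rewrite le_eqVlt => /predU1P[->//|uv].
    by rewrite lerN2; exact: slope_nonincreasing.
  near=> x; exists 0 => _ [y /= + <-]; rewrite in_itv /= => /andP[_ y0].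
  by rewrite oppr_le0; exact: slope_ge0.
move=> /is_cvgN; rewrite /marginal_utility ltxx.
by rewrite (_ : - _ = fun h => slope h) //; apply/funext => h; exact: opprK.
Unshelve. all: by end_near. Qed.

Lemma concave_tangent_end b : b < c -> U b - U c <= U' c * (b - c).
Proof.
move=> bc; have bc0 : b - c < 0 by rewrite subr_lt0.
rewrite -ler_ndivlMr // -(cvg_lim _ slope_cvg) //.
apply: limr_le; first by apply/cvg_ex; eexists; exact: slope_cvg.
near=> h.
have h0 : h < 0 by near: h; exact: nbhs_left_lt.
have hb : b - c < h by near: h; exact: nbhs_left_gt.
by have := slope_nonincreasing hb h0; rewrite [c + (b - c)]addrC subrK mulrC [X in _ <= X]mulrC.
Unshelve. all: by end_near. Qed.

Lemma concave_tangent a b : a <= c -> b <= c -> U b - U a <= U' a * (b - a).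
Proof.
rewrite le_eqVlt => /predU1P[->|ac bc]; last exact: concave_tangent_interior.
rewrite le_eqVlt => /predU1P[->|bc]; first by rewrite !subrr mulr0.
exact: concave_tangent_end.
Qed.

Lemma marginal_utility_end y : c <= y -> U' y = U' c.
Proof. by move=> cy; rewrite /marginal_utility ltxx ltNge cy. Qed.

Lemma marginal_utility_nonincreasing : {homo U' : x y /~ x <= y}.
Proof.
have H x y : x < y -> y <= c -> U' y <= U' x.
  move=> xy yc; have xc : x <= c by lra.
  have := concave_tangent xc yc; have := concave_tangent yc xc; nra.
move=> y x; rewrite le_eqVlt => /predU1P[->//|xy].
have [yc|/ltW cy] := leP y c; first exact: H.
rewrite (marginal_utility_end cy).
have [xc|cx] := ltP x c; first exact: H.
by rewrite marginal_utility_end.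
Qed.

Lemma marginal_utility_ge0 y : 0 <= U' y.
Proof.
have : U' c <= U' y.
  have [yc|/ltW cy] := leP y c; first exact: marginal_utility_nonincreasing.
  by rewrite (marginal_utility_end cy).
apply: le_trans; rewrite -(cvg_lim _ slope_cvg) //.
apply: limr_ge; first by apply/cvg_ex; eexists; exact: slope_cvg.
near=> h; apply: slope_ge0.
by near: h; exact: nbhs_left_lt.
Unshelve. all: by end_near. Qed.

(** At the endpoint, [U'] just to the left of [c] is squeezed between the left
    derivative and a difference quotient of [U] close to it. *)
Lemma marginal_utility_continuous : continuous U'.
Proof.
move=> y; have [yc|cy|->] := ltgtP y c.
- have /U'_cont cU : y \in `]-oo, c[ by rewrite in_itv.
  rewrite /continuous_at {2}/marginal_utility yc.
  apply: cvg_trans cU; apply: near_eq_cvg; near=> x.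
  rewrite /marginal_utility; suff -> : x < c by [].
  by near: x; exact: lt_nbhsl.
- rewrite /continuous_at (marginal_utility_end (ltW cy)).
  apply: cvg_near_cst; near=> x.
  rewrite marginal_utility_end // ltW //.
  by near: x; exact: lt_nbhsr.
- apply/cvgrPdist_lt => e e0.
  have [h [h0 He]] : exists h, h < 0 /\ slope h < U' c + e.
    have : \forall h \near (0 : R)^'-, h < 0 /\ slope h < U' c + e.
      apply: filterI; first exact: nbhs_left_lt.
      have /cvgrPdist_lt/(_ _ e0) := slope_cvg; apply: filterS => h.
      by rewrite ltr_distlC => /andP[].
    by move=> /filter_ex [h ?]; exists h.
  have cU : {for c, continuous (fun y => h^-1 * (U (y + h) - U c))}.
    apply: cvgM; first exact: cvg_cst.
    apply: cvgB; last exact: cvg_cst.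
    apply: (@continuous_comp _ _ _ (fun y => y + h)).
      by apply: cvgD; [exact: cvg_id|exact: cvg_cst].
    apply: differentiable_continuous; apply/derivable1_diffP/U_derivable.
    by rewrite in_itv /=; lra.
  have : \forall y \near c, h^-1 * (U (y + h) - U c) < U' c + e.
    exact: (cvgr_lt _ cU).
  apply: filterS => {}y Hy.
  have [cy|yc] := leP c y; first by rewrite (marginal_utility_end cy) subrr normr0.
  have le1 : U' c <= U' y by apply: marginal_utility_nonincreasing; exact: ltW.
  have le2 : U' y <= h^-1 * (U (y + h) - U c).
    have yhc : y + h <= c by lra.
    have H1 : U (y + h) - U y <= U' y * h.
      by have := concave_tangent (ltW yc) yhc; rewrite (_ : y + h - y = h) //; ring.
    have Uyc : U y <= U c by apply: U_nondecreasing; rewrite ?in_itv /=; lra.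
    by rewrite ler_ndivlMl //; lra.
  by rewrite ltr_distlC; apply/andP; split; lra.
Unshelve. all: by end_near. Qed.

End concave_utility.

(** * Integrals of real functions *)

Section integral_toolkit.
Context d (T : measurableType d) (R : realType) (mu : {measure set T -> \bar R}).
Implicit Types f g : T -> R.
Local Notation summable f := (mu.-integrable [set: T] (EFin \o f)).

Lemma ae_eq_Rintegral f g : measurable_fun setT f -> measurable_fun setT g ->
  {ae mu, forall x, f x = g x} -> \int[mu]_x f x = \int[mu]_x g x.
Proof.
move=> mf mg fg; rewrite /Rintegral; congr fine; apply: ae_eq_integral => //.
- exact/measurable_EFinP.
- exact/measurable_EFinP.
- by apply: filterS fg => x -> _.
Qed.

Lemma Rintegral_ge0_ae f : measurable_fun setT f ->
  {ae mu, forall x, 0 <= f x} -> 0 <= \int[mu]_x f x.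
Proof.
move=> mf f0; rewrite (@ae_eq_Rintegral _ (fun x => `|f x|)) //.
- by apply: Rintegral_ge0.
- exact: measurableT_comp.
- by apply: filterS f0 => x fx; rewrite ger0_norm.
Qed.

Lemma ae_le_Rintegral f g : summable f -> summable g ->
  {ae mu, forall x, f x <= g x} -> \int[mu]_x f x <= \int[mu]_x g x.
Proof.
move=> sf sg fg; rewrite -subr_ge0 -RintegralB //; apply: Rintegral_ge0_ae.
  by apply: measurable_funB; apply/measurable_EFinP; apply: measurable_int; eauto.
by apply: filterS fg => x; rewrite subr_ge0.
Qed.

Lemma ae_le_integrable f g : measurable_fun setT f ->
  {ae mu, forall x, `|f x| <= g x} -> summable g -> summable f.
Proof.
move=> mf fg sg; apply/integrableP; split; first exact/measurable_EFinP.
have /integrableP[mg] := sg; apply: le_lt_trans.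
apply: ae_ge0_le_integral => //.
- by apply/measurable_EFinP; exact: measurableT_comp.
- by apply: measurableT_comp.
- by apply: filterS fg => x fgx _; rewrite lee_fin (le_trans fgx) // ler_norm.
Qed.

Lemma Rintegral_eq0_ae f : summable f -> {ae mu, forall x, 0 <= f x} ->
  \int[mu]_x f x = 0 -> {ae mu, forall x, f x = 0}.
Proof.
move=> sf f0 int0.
have mf : measurable_fun setT (EFin \o f) by exact: measurable_int sf.
suff : ae_eq mu setT (EFin \o f) (cst 0%E).
  by apply: filterS => x /(_ I) [].
apply/ae_eq_integral_abs => //.
have -> : (\int[mu]_x `|(EFin \o f) x| = \int[mu]_x (EFin \o f) x)%E.
  apply: ae_eq_integral => //; first by apply: measurableT_comp.
  by apply: filterS f0 => x fx _ /=; rewrite ger0_norm.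
rewrite -[LHS]fineK; last by apply: integrable_fin_num sf.
by move: int0; rewrite /Rintegral => ->.
Qed.

Lemma dominated_Rintegral (f_ : nat -> T -> R) f g :
  (forall n, measurable_fun setT (f_ n)) -> measurable_fun setT f ->
  {ae mu, forall x, f_ ^~ x @ \oo --> f x} ->
  {ae mu, forall x n, `|f_ n x| <= g x} ->
  summable g ->
  summable f /\ (\int[mu]_x f_ n x) @[n --> \oo] --> \int[mu]_x f x.
Proof.
move=> mf_ mf f_f f_g sg.
have [] := @dominated_convergence _ _ _ mu setT measurableT
  (fun n => EFin \o f_ n) (EFin \o f) (EFin \o g).
- by move=> n; exact/measurable_EFinP.
- exact/measurable_EFinP.
- by apply: filterS f_f => x fx _; apply: cvg_EFin => //; exact: nearW.
- exact: sg.
- by apply: filterS f_g => x fx n _; rewrite lee_fin.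
move=> sf _ cf; split => //; apply: fine_cvg.
by rewrite /Rintegral fineK //; exact: integrable_fin_num sf.
Qed.

End integral_toolkit.

Lemma ae_probability_exists d (T : measurableType d) (R : realType)
    (P : probability T R) (Q : T -> Prop) :
  {ae P, forall w, Q w} -> exists w, Q w.
Proof.
have P0 : (0 < P setT)%E by rewrite probability_setT lte01.
have FF := ae_properfilter_algebraOfSetsType P0.
exact: filter_ex.
Qed.

Lemma Rintegral_probability_cst d (T : measurableType d) (R : realType)
  (P : probability T R) (r : R) : \int[P]_w (fun=> r) w = r.
Proof. by rewrite Rintegral_cst // (congr1 fine (probability_setT P)) mulr1. Qed.

(** * Moment vectors *)

(** The expression in parentheses is [l] times the gap between [a ^+ l.+1], a
    convex function of [a ^+ l], and its tangent at [a = tau].  By induction on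
    [l], the recurrence makes it nonnegative and locates its zeros. *)
Lemma power_tangent_gap (R : realFieldType) (tau a : R) l :
  l.+1%:R * a ^+ l.+2 - l.+2%:R * tau * a ^+ l.+1 + tau ^+ l.+2 =
  tau * (l%:R * a ^+ l.+1 - l.+1%:R * tau * a ^+ l + tau ^+ l.+1) +
  l.+1%:R * a ^+ l * (a - tau) ^+ 2.
Proof. rewrite !exprS -[l.+2]addn2 -[l.+1]addn1 !natrD; ring. Qed.

Lemma power_tangent_ge0 (R : realFieldType) (tau a : R) l : 0 <= tau -> 0 <= a ->
  0 <= l%:R * a ^+ l.+1 - l.+1%:R * tau * a ^+ l + tau ^+ l.+1.
Proof.
move=> t0 a0; elim: l => [|l IHl]; first by rewrite !expr1 expr0; lra.
rewrite power_tangent_gap; apply: addr_ge0; first exact: mulr_ge0.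
by apply: mulr_ge0; [rewrite mulr_ge0 // exprn_ge0|exact: sqr_ge0].
Qed.

Lemma power_tangent_eq0 (R : realFieldType) (tau a : R) l : 0 <= tau -> 0 <= a ->
  l.+1%:R * a ^+ l.+2 - l.+2%:R * tau * a ^+ l.+1 + tau ^+ l.+2 = 0 -> a = tau.
Proof.
move=> t0 a0; have [-> /eqP|a_neq0] := eqVneq a 0.
  rewrite !expr0n /= !mulr0 subr0 add0r expf_eq0 /= => /eqP ->; reflexivity.
rewrite power_tangent_gap => /eqP.
have g0 := power_tangent_ge0 l t0 a0.
rewrite paddr_eq0; last 2 first.
- by rewrite mulr_ge0.
- by apply: mulr_ge0; [rewrite mulr_ge0 // exprn_ge0|exact: sqr_ge0].
move=> /andP[_]; rewrite !mulf_eq0 pnatr_eq0 !expf_eq0 (negPf a_neq0) andbF /=.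
by rewrite orbb subr_eq0 => /eqP.
Qed.

Section moments.
Context d (T : measurableType d) (R : realType) (P : probability T R).
Variables (k : nat) (Z Z' : T -> R).
Hypotheses (Z_ge0 : {ae P, forall w, 0 <= Z w})
           (Z'_ge0 : {ae P, forall w, 0 <= Z' w}).
Local Notation summable f := (P.-integrable [set: T] (EFin \o f)).
Hypotheses (iZ : forall p, (p <= k)%N -> summable (fun w => Z w ^+ p))
           (iZ' : forall p, (p <= k)%N -> summable (fun w => Z' w ^+ p)).
Hypothesis non_cst :
  ~ exists tau, {ae P, forall w, Z w = tau} /\ {ae P, forall w, Z' w = tau}.
Variables (t : R) (t0 : 0 < t) (t1 : t < 1).

Local Notation mix F := ((1 - t) * (\int[P]_w F (Z w)) + t * (\int[P]_w F (Z' w))).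

(** Mixing is done on the integrals, so that no mixed law has to be built. *)
Lemma mix_gt0 (tau : R) (F : R -> R) :
  (forall a, 0 <= a -> 0 <= F a) -> (forall a, 0 <= a -> F a = 0 -> a = tau) ->
  summable (F \o Z) -> summable (F \o Z') ->
  0 < mix F.
Proof.
move=> F0 Ftau sF sF'.
have I0 (Y : T -> R) : {ae P, forall w, 0 <= Y w} -> summable (F \o Y) ->
    0 <= \int[P]_w F (Y w).
  move=> Y0 sY; apply: Rintegral_ge0_ae.
    by apply/measurable_EFinP; exact: measurable_int sY.
  by apply: filterS Y0 => w /F0.
have I1 (Y : T -> R) : {ae P, forall w, 0 <= Y w} -> summable (F \o Y) ->
    \int[P]_w F (Y w) = 0 -> {ae P, forall w, Y w = tau}.
  move=> Y0 sY /Rintegral_eq0_ae; move/(_ sY) => H.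
  have FY : {ae P, forall w, 0 <= F (Y w)} by apply: filterS Y0 => w /F0.
  by apply: filterS2 (H FY) Y0 => w + Yw; exact: Ftau.
have aZ : 0 <= (1 - t) * \int[P]_w F (Z w).
  by apply: mulr_ge0; [rewrite subr_ge0 ltW|exact: I0].
have aZ' : 0 <= t * \int[P]_w F (Z' w).
  by apply: mulr_ge0; [exact: ltW|exact: I0].
rewrite lt_neqAle addr_ge0 // andbT.
apply/eqP => /esym /eqP; rewrite paddr_eq0 //.
rewrite !mulf_eq0 (gt_eqF t0) /= subr_eq0 (gt_eqF t1) /= => /andP[/eqP H /eqP H'].
by apply: non_cst; exists tau; split; [exact: I1 sF H|exact: I1 sF' H'].
Qed.

Local Notation moment p := (mix (fun a => a ^+ p)).

Lemma moment_gt0 p : (p < k)%N -> 0 < moment p.+1.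
Proof.
move=> pk; apply: (@mix_gt0 0) => [a a0|a a0 /eqP| |]; first exact: exprn_ge0.
- by rewrite expf_eq0 /= => /eqP.
- exact: iZ.
- exact: iZ'.
Qed.

(** Strict Lyapunov inequality for a mixture.  The gap of
    [power_tangent_gap] is affine in the powers, so its mean is an affine
    expression in the moments; with the tangent taken at [tau], the norm of
    order [p + 1], this expression is a positive multiple of [moment p.+2 - tau ^+ p.+2]. *)
Lemma moment_lyapunov p : (p.+1 < k)%N ->
  moment p.+1 `^ p.+1%:R^-1 < moment p.+2 `^ p.+2%:R^-1.
Proof.
move=> pk; have m1 := moment_gt0 (ltnW pk); have m2 := moment_gt0 pk.
set tau := moment p.+1 `^ p.+1%:R^-1.
have tau0 : 0 < tau by rewrite powR_gt0.
have tauE : tau ^+ p.+1 = moment p.+1.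
  by rewrite -powR_mulrn ?ltW // -powRrM mulVf ?pnatr_eq0 // powRr1 // ltW.
pose F a := p.+1%:R * a ^+ p.+2 - p.+2%:R * tau * a ^+ p.+1 + tau ^+ p.+2.
have sF (Y : T -> R) : (forall q, (q <= k)%N -> summable (fun w => Y w ^+ q)) ->
    summable (F \o Y) /\ \int[P]_w F (Y w) =
      p.+1%:R * \int[P]_w (Y w ^+ p.+2)
      - p.+2%:R * tau * \int[P]_w (Y w ^+ p.+1) + tau ^+ p.+2.
  move=> iY.
  have s1 : summable (fun w => p.+1%:R * Y w ^+ p.+2).
    exact: (integrableZl measurableT p.+1%:R (iY _ pk)).
  have s2 : summable (fun w => p.+2%:R * tau * Y w ^+ p.+1).
    exact: (integrableZl measurableT (p.+2%:R * tau) (iY _ (ltnW pk))).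
  have s12 : summable (fun w => p.+1%:R * Y w ^+ p.+2 - p.+2%:R * tau * Y w ^+ p.+1).
    exact: (integrableB measurableT s1 s2).
  have s3 : summable (fun=> tau ^+ p.+2) by exact: finite_measure_integrable_cst.
  split; first exact: (integrableD measurableT s12 s3).
  rewrite RintegralD // RintegralB //.
  rewrite (@RintegralZl _ _ _ _ _ _ _ measurableT (iY _ pk)).
  rewrite (@RintegralZl _ _ _ _ _ _ _ measurableT (iY _ (ltnW pk))).
  by rewrite Rintegral_probability_cst.
have : 0 < mix F.
  have [sZ _] := sF _ iZ; have [sZ' _] := sF _ iZ'.
  apply: (@mix_gt0 tau) => // a a0.
    by apply: power_tangent_ge0 => //; exact: ltW.
  by apply: power_tangent_eq0 => //; exact: ltW.
rewrite (proj2 (sF _ iZ)) (proj2 (sF _ iZ')).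
have -> : (1 - t) *
  (p.+1%:R * \int[P]_w Z w ^+ p.+2 - p.+2%:R * tau * \int[P]_w Z w ^+ p.+1 + tau ^+ p.+2) +
  t * (p.+1%:R * \int[P]_w Z' w ^+ p.+2 - p.+2%:R * tau * \int[P]_w Z' w ^+ p.+1 + tau ^+ p.+2)
  = p.+1%:R * moment p.+2 - p.+2%:R * tau * moment p.+1 + tau ^+ p.+2 by ring.
have -> : p.+2%:R * tau * moment p.+1 = (p.+1%:R + 1) * tau ^+ p.+2.
  by rewrite -tauE -mulrA -exprS -natr1.
move: (moment p.+2) => M2 in m2 *.
rewrite (_ : _ + _ = p.+1%:R * (M2 - tau ^+ p.+2)); last by ring.
rewrite pmulr_rgt0; last by rewrite ltr0n.
rewrite subr_gt0 => H; rewrite -[ltLHS](_ : (tau ^+ p.+2) `^ p.+2%:R^-1 = _).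
  by apply: gt0_ltr_powR; rewrite ?nnegrE ?invr_gt0 ?ltr0n ?exprn_ge0 // ltW.
by rewrite -powR_mulrn ?ltW // -powRrM mulfV ?pnatr_eq0 // powRr1 // ltW.
Qed.

(** The powers [u_l^(1/l)] increase strictly at each step, hence overall. *)
Lemma mixed_moments_in_D :
  Dset (\row_(l < k) moment l.+1).
Proof.
split=> [l|l m lm]; rewrite !mxE; first exact: moment_gt0.
have chain (q : nat) : (q + l.+1 < k)%N ->
    moment l.+1 `^ l.+1%:R^-1 < moment (q + l.+1).+1 `^ (q + l.+1).+1%:R^-1.
  elim: q => [|q IHq] qk; first exact: moment_lyapunov.
  by apply: lt_trans (IHq (ltnW qk)) _; exact: moment_lyapunov.
by have := chain (m - l.+1)%N; rewrite subnK //; apply.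
Qed.

End moments.

(** * Increments of a premium along segments *)

Lemma cvg_mx (I : Type) (F : set_system I) (FF : Filter F) (T : topologicalType)
    m n (f : I -> 'M[T]_(m, n)) (M : 'M[T]_(m, n)) :
  (forall i j, f x i j @[x --> F] --> M i j) -> f @ F --> M.
Proof.
move=> fM A [B MB BA].
have : \forall x \near F, forall ij : 'I_m * 'I_n, B ij.1 ij.2 (f x ij.1 ij.2).
  by apply: filter_forall => -[i j]; apply: fM; exact: MB.
by apply: filterS => x Bx; apply: BA => i j; exact: (Bx (i, j)).
Qed.

Section premium_increment.
Variables (R : realType) (k : nat) (Psi : 'rV[R]_k -> R).
Hypothesis Psi_cont : {within @orthant R k, continuous Psi}.
Hypothesis Psi_diff : forall u, Dset u -> differentiable Psi u.

Local Notation segment u v t := (u + t *: (v - u)).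

Lemma deriv_gradient (xi w : 'rV[R]_k) : differentiable Psi xi ->
  'D_w Psi xi = \sum_(l < k) gradient Psi xi 0 l * w 0 l.
Proof.
move=> dPsi; rewrite deriveE // {1}(row_sum_delta w) linear_sum /=.
by apply: eq_bigr => l _; rewrite linearZ /= mxE deriveE // mulrC.
Qed.

Lemma orthant_segment u v t : @orthant R k u -> @orthant R k v -> 0 <= t <= 1 ->
  @orthant R k (segment u v t).
Proof.
move=> u0 v0 /andP[t0 t1] l; rewrite !mxE.
rewrite (_ : _ + _ = (1 - t) * u 0 l + t * v 0 l); last by ring.
by rewrite addr_ge0 // mulr_ge0 // subr_ge0.
Qed.

Lemma gradient_mean_value u v : @orthant R k u -> @orthant R k v ->
  (forall t, 0 < t < 1 -> Dset (segment u v t)) ->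
  exists2 t, 0 < t < 1 & Psi v - Psi u =
    \sum_(l < k) gradient Psi (segment u v t) 0 l * (v 0 l - u 0 l).
Proof.
move=> u0 v0 Duv.
pose f (t : R) := Psi (segment u v t).
have df (t : R) : t \in `]0, 1[ ->
    is_derive t 1 f ('D_(v - u) Psi (segment u v t)).
  rewrite in_itv /= => /Duv/Psi_diff dPsi.
  have E (h : R) : (f \o shift t) (h *: 1) = (Psi \o shift (segment u v t)) (h *: (v - u)).
    by rewrite /f /=; congr Psi; rewrite -[h *: 1]/(h * 1) mulr1 scalerDl addrCA.
  have /cvg_ex[l dl] := @diff_derivable _ _ _ _ _ (v - u) dPsi.
  split.
    rewrite /derivable; under eq_fun do rewrite E.
    by apply/cvg_ex; exists l.
  by rewrite /derive; under eq_fun do rewrite E.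
have cseg : continuous (fun s : R => segment u v s).
  move=> t; apply: cvgD; first exact: cvg_cst.
  by apply: (@cvgZr_tmp _ _ _ (nbhs t) _ id) => //.
have cf : {within `[0, 1], continuous f}.
  apply/subspace_continuousP => t; rewrite /= in_itv /= => t01 A.
  have /subspace_continuousP/(_ _ (orthant_segment u0 v0 t01)) := Psi_cont.
  move=> /[apply] PA.
  have {}PA : \forall y \near segment u v t, orthant y -> A (Psi y) by exact: PA.
  suff : \forall s \near (t : R), `[0, 1]%classic s -> A (f s) by [].
  have {}PA : \forall s \near (t : R), orthant (segment u v s) -> A (f s).
    exact: cseg t _ PA.
  apply: filterS PA => s /= HA; rewrite in_itv /= => s01.
  by apply: HA; exact: orthant_segment.
have [t t01] := MVT ltr01 df cf.
rewrite /f scale0r addr0 scale1r (addrC u) subrK subr0 mulr1 => ->.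
exists t; first by move: t01; rewrite in_itv.
have Dt : Dset (segment u v t) by apply: Duv; move: t01; rewrite in_itv.
rewrite deriv_gradient; last exact: Psi_diff.
by apply: eq_bigr => l _; rewrite !mxE.
Qed.

(** Only the behaviour of the gradient inside [Dset] near [u] matters: the
    mean value theorem on the segments, whose interior lies in [Dset], turns it
    into a one-sided derivative at [u], even if [u] lies outside [Dset]. *)
Lemma premium_increment (u g : 'rV[R]_k) (v : nat -> 'rV[R]_k) (s : nat -> R) (w : 'rV[R]_k) :
  orthant u -> (forall n, orthant (v n)) ->
  gradient Psi x @[x --> within (@Dset R k) (nbhs u)] --> g ->
  (forall n, v n <> u -> forall t, 0 < t < 1 -> Dset (segment u (v n) t)) ->
  v @ \oo --> u ->
  (forall l, (s n)^-1 * (v n 0 l - u 0 l) @[n --> \oo] --> w 0 l) ->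
  (s n)^-1 * (Psi (v n) - Psi u) @[n --> \oo] --> \sum_(l < k) g 0 l * w 0 l.
Proof.
move=> u0 v0 gradg Dv vu vw.
have ex n : exists t, 0 < t < 1 /\ (v n <> u -> Psi (v n) - Psi u =
    \sum_(l < k) gradient Psi (segment u (v n) t) 0 l * (v n 0 l - u 0 l)).
  have [vnu|vnu] := pselect (v n = u).
    by exists 2^-1; split=> //; lra.
  have [t t01 H] := gradient_mean_value u0 (v0 n) (Dv n vnu).
  by exists t.
have [t {}ex] := choice ex.
pose gam n := if `[< v n = u >] then g else gradient Psi (segment u (v n) (t n)).
have incr n : (s n)^-1 * (Psi (v n) - Psi u) =
    \sum_(l < k) gam n 0 l * ((s n)^-1 * (v n 0 l - u 0 l)).
  rewrite /gam; case: asboolP => [->|vnu].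
    by rewrite subrr mulr0 big1 // => l _; rewrite subrr !mulr0.
  have [_ ->//] := ex n; rewrite mulr_sumr; apply: eq_bigr => l _.
  by rewrite mulrCA.
have seg_u : segment u (v n) (t n) @[n --> \oo] --> u.
  apply: cvg_mx => a l; rewrite (ord1 a).
  have vul : v n 0 l @[n --> \oo] --> u 0 l.
    exact: (cvg_comp _ _ vu (@coord_continuous _ _ _ 0 l u)).
  apply/cvgrPdist_lt => e e0.
  have /cvgrPdist_lt/(_ _ e0) := vul; apply: filterS => n.
  apply: le_lt_trans; rewrite !mxE opprD addrA subrr sub0r normrN normrM distrC.
  have [/andP[t0 t1] _] := ex n.
  by rewrite ler_piMl // gtr0_norm // ltW.
have gam_g : gam @ \oo --> g.
  move=> A Ag; have /= := gradg _ Ag; rewrite /nbhs /= /within /= => DA.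
  have {}DA : \forall n \near \oo, Dset (segment u (v n) (t n)) ->
      A (gradient Psi (segment u (v n) (t n))) by exact: seg_u _ DA.
  apply: filterS DA => n /= H; rewrite /gam.
  case: asboolP => [_|vnu]; first exact: nbhs_singleton.
  by apply: H; apply: Dv => //; have [] := ex n.
rewrite (_ : (fun n => _) =
    (fun n => \sum_(l < k) gam n 0 l * ((s n)^-1 * (v n 0 l - u 0 l)))); last exact/funext.
apply: cvg_big => [|l _]; first exact: add_continuous.
 apply: cvgM => //.
exact: (cvg_comp _ _ gam_g (@coord_continuous _ _ _ 0 l g)).
Qed.

End premium_increment.

(** * The extended gradient at a moment vector *)

Section extended_gradient.
Context d (T : measurableType d) (R : realType) (P : probability T R).
Variables (k : nat) (Psi : 'rV[R]_k -> R) (Z : T -> R).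
Hypothesis Psi_C1 : continuously_differentiable_on_D Psi.
Hypotheses (mZ : measurable_fun setT Z) (Z_ge0 : {ae P, forall w, 0 <= Z w}).
Hypothesis iZ : forall p, (p <= k)%N ->
  P.-integrable [set: T] (EFin \o (fun w => Z w ^+ p)).
Hypothesis A1 : gradient_extends_to_Delta Psi \/
  ~ exists z, {ae P, forall w, Z w = z}.

Local Notation u := (\row_(l < k) \int[P]_w (Z w ^+ l.+1)).

Lemma moments_in_D : ~ (exists z, {ae P, forall w, Z w = z}) -> Dset u.
Proof.
move=> ncst.
have -> : u = \row_(l < k) ((1 - 2^-1) * (\int[P]_w (Z w ^+ l.+1)) +
                            2^-1 * (\int[P]_w (Z w ^+ l.+1))).
  by apply/rowP => l; rewrite !mxE; field.
apply: mixed_moments_in_D => //; [|lra..].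
by move=> [z [Zz _]]; apply: ncst; exists z.
Qed.

Lemma cst_moments_in_Delta z : 0 <= z ->
  @Deltaset R k (\row_(l < k) z ^+ l.+1).
Proof.
move=> z0.
have pE (l : 'I_k) : (z ^+ l.+1) `^ l.+1%:R^-1 = z.
  by rewrite -powR_mulrn // -powRrM mulfV ?pnatr_eq0 // powRr1.
by split=> [l|l m]; rewrite !mxE ?exprn_ge0 ?pE.
Qed.

(** Moment vectors of the two-point laws [(1 - t) delta_z + t delta_(z+1)] lie
    in [Dset] and tend to that of [delta_z].  This makes the filter defining
    [extended_gradient] proper, so that its limit is unique. *)
Lemma cst_moments_in_closure_D z : 0 <= z ->
  closure (@Dset R k) (\row_(l < k) z ^+ l.+1).
Proof.
move=> z0.
pose x (t : R) : 'rV[R]_k := \row_(l < k) ((1 - t) * z ^+ l.+1 + t * (z + 1) ^+ l.+1).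
have x0 : x 0 = \row_(l < k) z ^+ l.+1.
  by apply/rowP => l; rewrite !mxE subr0 mul1r mul0r addr0.
have cx : x @ (0 : R)^'+ --> \row_(l < k) z ^+ l.+1.
  apply: cvg_at_right_filter; rewrite -x0.
  apply: cvg_mx => a l; rewrite !mxE; under eq_fun do rewrite mxE.
  apply: cvgD; apply: cvgMr_tmp; last by [].
  by apply: cvgB; [exact: cvg_cst|exact: cvg_id].
have xD t : 0 < t < 1 -> Dset (x t).
  move=> /andP[t0 t1].
  have -> : x t = \row_(l < k) ((1 - t) * (\int[P]_w ((fun=> z) w ^+ l.+1)) +
                            t * (\int[P]_w ((fun=> z + 1) w ^+ l.+1))).
    by apply/rowP => l; rewrite !mxE !Rintegral_probability_cst.
  apply: mixed_moments_in_D => //.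
  - exact: nearW.
  - by apply: nearW => w; lra.
  - by move=> p _; exact: finite_measure_integrable_cst.
  - by move=> p _; exact: finite_measure_integrable_cst.
  - move=> [tau [/ae_probability_exists [_ h1] /ae_probability_exists [_ h2]]]; lra.
move=> B /cx xB.
have : \forall t \near (0 : R)^'+, B (x t) /\ 0 < t < 1.
  apply: filterI => //; near=> t; apply/andP; split.
    by near: t; exact: nbhs_right_gt.
  by near: t; exact: nbhs_right_lt.
by move=> /(@filter_ex _ _ (at_right_proper_filter _)) [t [Bt /xD Dt]]; exists (x t).
Unshelve. all: by end_near. Qed.

(** Outside [Dset] the variable is almost surely constant, and then the first
    alternative of [A1] has to hold; its extension gives the limit. *)
Lemma gradient_cvg_extended :
  gradient Psi x @[x --> within (@Dset R k) (nbhs u)] --> extended_gradient Psi u.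
Proof.
rewrite /extended_gradient; case: asboolP => Du.
  by have /subspace_continuousP/(_ _ Du) := proj2 Psi_C1.
have [z Zz] : exists z, {ae P, forall w, Z w = z}.
  by apply: contrapT => /moments_in_D.
have [[G [cG GD]]|] := A1; last by move=> []; exists z.
have z0 : 0 <= z.
  have : \forall w \ae P, 0 <= z by apply: filterS2 Zz Z_ge0 => w ->.
  by move=> /ae_probability_exists [].
have uE : u = \row_(l < k) z ^+ l.+1.
  apply/rowP => l; rewrite !mxE -[RHS](Rintegral_probability_cst P).
  apply: ae_eq_Rintegral => //; first exact: measurable_funX.
  by apply: filterS Zz => w ->.
have H : gradient Psi x @[x --> within (@Dset R k) (nbhs u)] --> G u.
  have uD : (@Dset R k `|` @Deltaset R k) u.
    by right; rewrite uE; exact: cst_moments_in_Delta.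
  have /subspace_continuousP/(_ _ uD) := cG.
  move=> + B GB => /(_ _ GB) HB.
  have {}HB : \forall x \near u, (@Dset R k `|` @Deltaset R k) x -> B (G x) by exact: HB.
  suff : \forall x \near u, @Dset R k x -> B (gradient Psi x) by [].
  by apply: filterS HB => x Hx Dx; rewrite -GD //; apply: Hx; left.
have PF : ProperFilter (within (@Dset R k) (nbhs u)).
  by apply: within_nbhs_proper; rewrite uE; exact: cst_moments_in_closure_D.
by rewrite (cvg_lim _ H).
Qed.

End extended_gradient.

(** * Conditional probabilities *)

Section slice_law.
Context d (T : measurableType d) (R : realType) (nu : probability T R).
Variables (Y : {mfun T >-> R}) (E : set T) (mE : measurable E).

(** Named so as to carry its own structure of finite measure, to which the
    Radon-Nikodym theorem applies. *)
Definition slice_law (C : set R) : \bar R := mrestr nu mE (Y @^-1` C).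

Let mY (C : set R) : measurable C -> measurable (Y @^-1` C).
Proof. by move=> mC; rewrite -[X in measurable X]setTI; exact: measurable_funP. Qed.

Let slice_law0 : slice_law set0 = 0%E.
Proof. by rewrite /slice_law preimage_set0 measure0. Qed.

Let slice_law_ge0 C : (0 <= slice_law C)%E.
Proof. exact: measure_ge0. Qed.

Let slice_law_sigma_additive : semi_sigma_additive slice_law.
Proof.
move=> F mF tF mUF; rewrite /slice_law preimage_bigcup.
apply: measure_semi_sigma_additive => [n| |]; first exact: mY.
- apply/trivIsetP => i j _ _ ij; rewrite -preimage_setI.
  by move/trivIsetP : tF => /(_ _ _ I I ij) ->; rewrite preimage_set0.
- by apply: bigcup_measurable => n _; exact: mY.
Qed.

HB.instance Definition _ := isMeasure.Build _ _ _ slice_law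
  slice_law0 slice_law_ge0 slice_law_sigma_additive.

Let slice_law_fin : fin_num_fun slice_law.
Proof. by move=> C mC; exact: fin_num_measure (measurableI _ _ (mY mC) mE). Qed.

HB.instance Definition _ := Measure_isFinite.Build _ _ _ slice_law slice_law_fin.

Lemma slice_law_dominated : slice_law `<< distribution nu Y.
Proof.
apply/null_content_dominatesP => C mC C0; apply/eqP.
rewrite eq_le measure_ge0 andbT -[leRHS]C0.
exact: (measureIl nu (mY mC) mE).
Qed.

Lemma integral_slice_law (f : R -> \bar R) (C : set R) : measurable C ->
  measurable_fun setT f -> (forall y, 0 <= f y)%E ->
  (\int[slice_law]_(y in C) f y = \int[nu]_(w in E `&` Y @^-1` C) f (Y w))%E.
Proof.
move=> mC mf f0.
have mYC := mY mC.
transitivity (\int[pushforward (mrestr nu mE) Y]_(y in C) f y)%E.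
  exact: eq_measure_integral.
rewrite ge0_integral_pushforward //; last exact: measurable_funTS.
set g := f \o Y; have mg : measurable_fun setT g by exact: measurableT_comp.
rewrite -[in LHS](setUIDK (Y @^-1` C) E) ge0_integral_setU //; last 5 first.
- exact: measurableI.
- exact: measurableD.
- exact: measurable_funTS.
- by move=> x _; exact: f0.
- by apply/disj_setPS => x [[_ Ex] [_ nEx]].
rewrite [X in (_ + X)%E](@null_set_integral _ _ _ _ (Y @^-1` C `\` E)); last 3 first.
- exact: measurableD.
- exact: measurable_funTS.
- by rewrite /= /mrestr setDE -setIA setICl setI0 measure0.
rewrite adde0 setIC; apply: eq_measure_integral => A mA AE.
by rewrite /= /mrestr setIidl // => x /AE[].
Qed.

End slice_law.

Section conditional_independence.
Context d (T : measurableType d) (R : realType) (nu : probability T R).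
Variable (Y : {mfun T >-> R}).
Local Notation law := (distribution nu Y).

Let mY (C : set R) : measurable C -> measurable (Y @^-1` C).
Proof. by move=> mC; rewrite -[X in measurable X]setTI; exact: measurable_funP. Qed.

(** The density of [slice_law] with respect to the law of [Y]; the last clause
    is the change of variables for this density, and says that the version
    found is the conditional expectation of the indicator of [E]. *)
Lemma cond_prob_exists (E : set T) : measurable E ->
  exists f : R -> R, [/\ is_cond_prob nu Y E f, forall y, 0 <= f y,
    law.-integrable setT (EFin \o f) &
    forall (phi : R -> R) C, measurable_fun setT phi -> (forall y, 0 <= phi y) ->
      measurable C ->
      (\int[nu]_(w in E `&` Y @^-1` C) (phi (Y w))%:E =
       \int[law]_(y in C) (phi y * f y)%:E)%E].
Proof.
move=> mE; have dom := @slice_law_dominated _ _ _ nu Y E mE.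
pose F := Radon_Nikodym_SigmaFinite.f (slice_law nu Y mE) law.
have F0 y : (0 <= F y)%E by exact: Radon_Nikodym_SigmaFinite.f_ge0.
have Ffin y : F y \is a fin_num by exact: Radon_Nikodym_SigmaFinite.f_fin_num.
have iF : law.-integrable setT F by exact: Radon_Nikodym_SigmaFinite.f_integrable.
have FE : EFin \o (fine \o F) = F by apply/funext => y /=; rewrite fineK.
have mF : measurable_fun setT (fine \o F).
  by apply/measurable_EFinP; rewrite FE; exact: measurable_int iF.
exists (fine \o F); split.
- split=> // C mC; rewrite setIC -[LHS]/(slice_law nu Y mE C).
  rewrite (Radon_Nikodym_SigmaFinite.f_integral dom) //.
  by apply: eq_integral => y _ /=; rewrite fineK.
- by move=> y; exact: fine_ge0.
- by rewrite FE.
- move=> phi C mphi phi0 mC.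
  rewrite -(@integral_slice_law _ _ _ nu Y E mE (EFin \o phi)) //; last first.
    exact/measurable_EFinP.
  rewrite -(Radon_Nikodym_SigmaFinite.change_of_variables dom) //; last first.
    by apply/measurable_EFinP; exact: measurable_funTS.
  by apply: eq_integral => y _ /=; rewrite EFinM fineK.
Qed.

Lemma cond_prob_unique (E : set T) (f g : R -> R) :
  is_cond_prob nu Y E f -> law.-integrable setT (EFin \o f) ->
  is_cond_prob nu Y E g -> {ae law, forall y, f y = g y}.
Proof.
move=> [mf Ef] iF [mg Eg].
have : ae_eq law setT (EFin \o f) (EFin \o g).
  apply: integral_ae_eq => //; first exact/measurable_EFinP.
  by move=> C _ mC; rewrite -Ef // -Eg.
by apply: filterS => y /(_ I) [].
Qed.

End conditional_independence.

(** * Conditional independence *)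

Section conditional_independence_stability.
Context d (T : measurableType d) (R : realType) (nu : probability T R).
Context d2 (T2 : measurableType d2).
Variables (Y Z : {mfun T >-> R}) (W : T -> T2).
Hypothesis mW : measurable_fun setT W.
Hypothesis indep : cond_indep nu Y Z W.
Local Notation law := (distribution nu Y).

Let mY (C : set R) : measurable C -> measurable (Y @^-1` C).
Proof. by move=> mC; rewrite -[X in measurable X]setTI; exact: measurable_funP. Qed.
Let mZ (C : set R) : measurable C -> measurable (Z @^-1` C).
Proof. by move=> mC; rewrite -[X in measurable X]setTI; exact: measurable_funP. Qed.
Let mWB (B : set T2) : measurable B -> measurable (W @^-1` B).
Proof. by move=> mB; rewrite -[X in measurable X]setTI; exact: mW. Qed.

Let YZ w : R * R := (Y w, Z w).
Let mYZ (F : set (R * R)) : measurable F -> measurable (YZ @^-1` F).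
Proof.
move=> mF; rewrite -[X in measurable X]setTI.
by apply: measurable_fun_pair => //; exact: measurable_funP.
Qed.

(** On rectangles this is conditional independence, once versions are identified
    almost everywhere; a Dynkin argument extends it to the plane.  In words,
    observing [Z] besides [Y] does not change the probability of [W \in B]. *)
Lemma cond_prob_given_pair B f : measurable B ->
  is_cond_prob nu Y (W @^-1` B) f -> (forall y, 0 <= f y) ->
  law.-integrable setT (EFin \o f) ->
  forall F, measurable F ->
    (nu (YZ @^-1` F `&` W @^-1` B) = \int[nu]_(w in YZ @^-1` F) (f (Y w))%:E)%E.
Proof.
move=> mB Bf f0 fi F mF.
have [mf _] := Bf.
have mfY : measurable_fun setT (fun w => (f (Y w))%:E).
  by apply/measurable_EFinP; exact: measurableT_comp.
have rect C A : measurable C -> measurable A ->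
    (nu (Y @^-1` C `&` Z @^-1` A `&` W @^-1` B) =
     \int[nu]_(w in Y @^-1` C `&` Z @^-1` A) (f (Y w))%:E)%E.
  move=> mC mA.
  have [g [gB [Ag Bg ABg]]] := indep mA mB.
  have [h [Ah h0 hi hE]] := @cond_prob_exists _ _ _ nu Y _ (mZ mA).
  have gh := cond_prob_unique Ah hi Ag.
  have fg := cond_prob_unique Bf fi Bg.
  rewrite (setIC (Y @^-1` C)) hE // setIAC (proj2 ABg) //.
  apply: ae_eq_integral => //.
  - by apply/measurable_EFinP; apply: measurable_funTS; exact: (proj1 ABg).
  - apply/measurable_EFinP; apply: measurable_funTS; apply: measurable_funM => //.
    exact: (proj1 Ah).
  - by apply: filterS2 gh fg => y gh fg _; rewrite /= -gh -fg mulrC.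
rewrite measurable_prod_measurableType in mF.
move: F mF; apply: dynkin_induction.
- exact: measurable_prod_measurableType.
- move=> _ _ [A mA [B' mB' <-]] [C mC [D mD <-]].
  by rewrite -setXI; exists (A `&` C); [exact: measurableI|exists (B' `&` D) => //; exact: measurableI].
- have := rect setT setT measurableT measurableT.
  by rewrite !preimage_setT !setTI.
- by move=> _ [C mC [A mA <-]]; exact: rect.
- move=> S mS ES; rewrite preimage_setC.
  have mYZS := mYZ mS.
  have := rect setT setT measurableT measurableT; rewrite !preimage_setT !setTI => E1.
  have E2 : (\int[nu]_w (f (Y w))%:E = \int[nu]_(w in YZ @^-1` S) (f (Y w))%:E
      + \int[nu]_(w in ~` (YZ @^-1` S)) (f (Y w))%:E)%E.
    rewrite -ge0_integral_setU ?setUv //.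
    + exact: measurableC.
    + by move=> w _; rewrite lee_fin.
    + by apply/disj_setPS; rewrite setICr.
  have E3 : nu (W @^-1` B) = (nu (YZ @^-1` S `&` W @^-1` B) +
      nu (~` (YZ @^-1` S) `&` W @^-1` B))%E.
    rewrite -measureU; last 3 first.
    + by apply: measurableI => //; exact: mWB.
    + by apply: measurableI; [exact: measurableC|exact: mWB].
    + by rewrite setIACA setICr set0I.
    by rewrite -setIUl setUv setTI.
  have fin : nu (YZ @^-1` S `&` W @^-1` B) \is a fin_num.
    by apply: fin_num_measure; apply: measurableI => //; exact: mWB.
  transitivity (nu (W @^-1` B) - nu (YZ @^-1` S `&` W @^-1` B))%E.
    by rewrite E3 [X in (X - _)%E]addeC addeK.
  by rewrite E1 E2 -ES [X in (X - _)%E]addeC addeK.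
- move=> F mF tF EF.
  rewrite preimage_bigcup setI_bigcupl ge0_integral_bigcup //; last 4 first.
  + by move=> n; exact: mYZ.
  + exact: measurable_funTS.
  + by move=> w _; rewrite lee_fin.
  + apply/trivIsetP => i j _ _ ij; rewrite -preimage_setI.
    by move/trivIsetP : tF => /(_ _ _ I I ij) ->; rewrite preimage_set0.
  rewrite measure_bigcup //; last 2 first.
  + by move=> n _; apply: measurableI; [exact: mYZ|exact: mWB].
  + apply/trivIsetP => i j _ _ ij; rewrite setIACA -preimage_setI.
    by move/trivIsetP : tF => /(_ _ _ I I ij) ->; rewrite preimage_set0 set0I.
  transitivity (\sum_(0 <= n <oo) nu (YZ @^-1` F n `&` W @^-1` B))%E.
    by apply: eq_eseriesl => n; rewrite in_setT.
  by apply: eq_eseriesr => n _; exact: EF.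
Qed.

(** This is what keeps a perturbed treaty admissible: it depends on [(Y, Z)]
    and no longer on [Z] alone. *)
Lemma cond_indep_function (a : R * R -> R) : measurable_fun setT a ->
  cond_indep nu Y (fun w => a (Y w, Z w)) W.
Proof.
move=> ma A B mA mB.
have maA : measurable (a @^-1` A) by rewrite -[X in measurable X]setTI; exact: ma.
have mE : measurable ((fun w => a (Y w, Z w)) @^-1` A) by exact: mYZ maA.
have [g [Ag g0 gi gE]] := @cond_prob_exists _ _ _ nu Y _ mE.
have [f [Bf f0 fi _]] := @cond_prob_exists _ _ _ nu Y _ (mWB mB).
exists g, f; split => //; split.
  by apply: measurable_funM; [exact: (proj1 Ag)|exact: (proj1 Bf)].
move=> C mC.
have mF : measurable (a @^-1` A `&` (fst @^-1` C)).
  apply: measurableI => //; rewrite -[X in measurable X]setTI.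
  exact: measurable_fst.
have := cond_prob_given_pair mB Bf f0 fi mF.
rewrite preimage_setI -[X in (_ `&` X) `&` _]/(Y @^-1` C).
rewrite setIAC => ->.
rewrite gE //; last exact: (proj1 Bf).
by apply: eq_integral => y _; rewrite /= mulrC.
Qed.

End conditional_independence_stability.

Section conditional_independence_transport.
Context d d' (T : measurableType d) (T' : measurableType d') (R : realType).
Variables (nu : probability T R) (tau : {mfun T >-> T'}).
Variables (Y : {mfun T >-> R}) (Y' : {mfun T' >-> R}).
Hypothesis YE : forall w, Y' (tau w) = Y w.

Lemma cond_prob_transport (E : set T') g :
  is_cond_prob nu Y (tau @^-1` E) g -> is_cond_prob (distribution nu tau) Y' E g.
Proof.
move=> [mg Eg]; split=> // C mC.
have YC (A : set R) : tau @^-1` (Y' @^-1` A) = Y @^-1` A.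
  by apply/seteqP; split => w /=; rewrite YE.
rewrite -[LHS]/(nu (tau @^-1` E `&` tau @^-1` (Y' @^-1` C))) YC Eg //.
apply: eq_measure_integral => A _ _.
by rewrite -[LHS]/(nu (Y @^-1` A)) -YC.
Qed.

Lemma cond_indep_transport d1 d2 (T1 : measurableType d1) (T2 : measurableType d2)
    (V : T' -> T1) (W : T' -> T2) :
  cond_indep nu Y (V \o tau) (W \o tau) ->
  cond_indep (distribution nu tau) Y' V W.
Proof.
move=> VW A B mA mB; have [gA [gB [Ag Bg ABg]]] := VW A B mA mB.
by exists gA, gB; split; exact: cond_prob_transport.
Qed.

End conditional_independence_transport.

Lemma cond_indep_comp_right d (T : measurableType d) (R : realType)
    (nu : probability T R) (Y : {mfun T >-> R}) d1 d2 d3 (T1 : measurableType d1)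
    (T2 : measurableType d2) (T3 : measurableType d3)
    (V : T -> T1) (W : T -> T2) (g : T2 -> T3) :
  measurable_fun setT g -> cond_indep nu Y V W -> cond_indep nu Y V (g \o W).
Proof.
move=> mg VW A B mA mB; apply: (VW A (g @^-1` B) mA).
by rewrite -[X in measurable X]setTI; exact: mg.
Qed.

(** * Weak topology and continuous maps *)

Section borel_maps.
Variables (R : realType) (T U : ptopologicalType).

Lemma continuous_borel_map (f : T -> U) : continuous f ->
  measurable_fun [set: borel T] (f : borel T -> borel U).
Proof.
move=> /continuousP cf; apply: (@measurability _ _ (borel T) (borel U) setT f (@open U)) => //.
by move=> _ [B oB <-]; rewrite setTI; apply: sub_sigma_algebra; exact: cf.
Qed.

Definition borel_map (f : T -> U) (cf : continuous f) :
    {mfun borel T >-> borel U} :=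
  HB.pack (f : borel T -> borel U)
    (isMeasurableFun.Build _ _ _ _ (f : borel T -> borel U) (continuous_borel_map cf)).

End borel_maps.

(** The change of variables needs no integrability: the positive and negative
    parts are transported separately. *)
Lemma integral_distribution_measurable d d' (T : measurableType d)
    (T' : measurableType d') (R : realType) (P : probability T R)
    (X : {mfun T >-> T'}) (f : T' -> \bar R) :
  measurable_fun setT f -> (\int[distribution P X]_y f y = \int[P]_w f (X w))%E.
Proof.
move=> mf; rewrite integralE [RHS]integralE.
rewrite !ge0_integral_distribution //.
- by rewrite -funepos_comp -funeneg_comp.
- exact: measurable_funeneg.
- exact: measurable_funepos.
Qed.

Lemma Rintegral_distribution d d' (T : measurableType d) (T' : measurableType d')
    (R : realType) (P : probability T R) (X : {mfun T >-> T'}) (f : T' -> R) :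
  measurable_fun setT f -> \int[distribution P X]_y f y = \int[P]_w f (X w).
Proof.
move=> mf; rewrite /Rintegral integral_distribution_measurable //.
exact/measurable_EFinP.
Qed.

Section weak_topology.
Variables (R : realType) (T : ptopologicalType).

Lemma bounded_continuous_integrable (mu : probability (borel T) R) (f : T -> R) :
  continuous f -> bounded_fun f -> mu.-integrable setT (EFin \o f).
Proof.
move=> cf bf; apply: measurable_bounded_integrable => //.
- by rewrite (le_lt_trans (probability_le1 _ _)) // ltry.
- exact: continuous_borel_measurable.
Qed.

Lemma weak_test_continuous (f : T -> R) : continuous f -> bounded_fun f ->
  continuous (fun nu : weak_probability R T => \int[(nu : probability (borel T) R)]_w f w).
Proof.
move=> cf bf nu.
pose F : {f : T -> R | continuous f /\ bounded_fun f} := exist _ f (conj cf bf).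
pose W (nu : probability (borel T) R) := \int[nu]_w f w.
have /cvg_sup/(_ F) H : nbhs (nu : weak_probability R T) --> (nu : weak_probability R T).
  by [].
have := @initial_continuous _ _ W nu.
exact: (cvg_comp _ _ H).
Qed.

Lemma weak_continuousP (S : topologicalType) (g : S -> weak_probability R T) :
  (forall f : T -> R, continuous f -> bounded_fun f ->
    continuous (fun x => \int[(g x : probability (borel T) R)]_w f w)) ->
  continuous g.
Proof.
move=> H x; apply/cvg_sup => -[f [cf bf]].
apply: (@continuous_comp_initial _ S R
  (fun nu : probability (borel T) R => \int[nu]_w f w) g).
exact: H.
Qed.

Lemma closure_pushforward (tau : T -> T) (ctau : continuous tau)
    (S : set (weak_probability R T)) :
  (forall mu : probability (borel T) R, S mu -> S (distribution mu (borel_map ctau))) ->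
  forall mu : probability (borel T) R,
    closure S mu -> closure S (distribution mu (borel_map ctau)).
Proof.
move=> Spush mu clS.
pose push (nu : weak_probability R T) : weak_probability R T :=
  distribution (nu : probability (borel T) R) (borel_map ctau).
have cpush : continuous push.
  apply: weak_continuousP => f cf bf.
  have cft : continuous (f \o tau) by move=> x; apply: continuous_comp; [exact: ctau|exact: cf].
  have bft : bounded_fun (f \o tau).
    case: bf => M [Mr HM]; exists M; split => // y My x _; exact: HM.
  rewrite (_ : (fun x => _) =
    (fun nu : weak_probability R T => \int[(nu : probability (borel T) R)]_w (f \o tau) w)).
    exact: weak_test_continuous.
  apply/funext => nu; apply: Rintegral_distribution.
  exact: continuous_borel_measurable.
move=> B /(cpush mu) /clS [nu [Snu Bnu]].
by exists (push nu); split => //; exact: Spush.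
Qed.

End weak_topology.

(** * Re-treating one risk *)

Lemma continuous_pair (S T U : topologicalType) (f : S -> T) (g : S -> U) :
  continuous f -> continuous g -> continuous (fun x => (f x, g x)).
Proof. by move=> cf cg x; exact: (cvg_pair (cf x) (cg x)). Qed.

Lemma fst_continuous (T U : topologicalType) : continuous (@fst T U).
Proof. by move=> x; exact: cvg_fst. Qed.

Lemma snd_continuous (T U : topologicalType) : continuous (@snd T U).
Proof. by move=> x; exact: cvg_snd. Qed.

Section coordinate_maps.
Variables (R : realType) (n : nat) (j : 'I_n).

Lemma xcoord_continuous : continuous (fun w : space2 R n => w.1 0 j).
Proof.
move=> w; apply: (@continuous_comp _ _ _ fst (fun x : 'rV[R]_n => x 0 j)).
  exact: fst_continuous.
exact: coord_continuous.
Qed.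

Lemma zcoord_continuous : continuous (fun w : space2 R n => w.2 0 j).
Proof.
move=> w; apply: (@continuous_comp _ _ _ snd (fun x : 'rV[R]_n => x 0 j)).
  exact: snd_continuous.
exact: coord_continuous.
Qed.

End coordinate_maps.

Lemma continuous_mx (S T : topologicalType) m n (f : S -> 'M[T]_(m, n)) :
  (forall i j, continuous (fun x => f x i j)) -> continuous f.
Proof. by move=> H x; apply: cvg_mx => i j; exact: H. Qed.

Section replacement.
Variables (R : realType) (n : nat) (i : 'I_n) (a : R * R -> R).

Definition replace_z (w : space2 R n) : space2 R n :=
  (w.1, \row_j if j == i then a (w.1 0 i, w.2 0 i) else w.2 0 j).

Lemma replace_z_continuous : continuous a -> continuous replace_z.
Proof.
move=> ca; apply: continuous_pair; first exact: fst_continuous.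
apply: continuous_mx => b j; under eq_fun do rewrite mxE.
case: eqP => _; last exact: zcoord_continuous.
move=> w; apply: (@continuous_comp _ _ _ (fun w : space2 R n => (w.1 0 i, w.2 0 i)) a).
  by apply: continuous_pair; [exact: xcoord_continuous|exact: zcoord_continuous].
exact: ca.
Qed.

Lemma others_replace_same w : others i (replace_z w) = others i w.
Proof.
rewrite /others /replace_z /=; congr (_, _); apply/rowP => l; rewrite !mxE.
by rewrite eq_sym (negPf (neq_lift i l)).
Qed.

End replacement.

Lemma others_replace_other (R : realType) n (i j : 'I_n) (l : 'I_n.-1)
    (a : R * R -> R) (w : space2 R n) : unlift j i = Some l ->
  others j (replace_z i a w) = replace_z l a (others j w).
Proof.
case: unliftP => // m im [<-]; rewrite /others /replace_z /=; congr (_, _).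
apply/rowP => p; rewrite !mxE -im; congr (if _ then _ else _).
by rewrite im (inj_eq (@lift_inj _ j)).
Qed.

Lemma others_continuous (R : realType) n (i : 'I_n) :
  continuous (@others R n i : space2 R n -> space2' R n).
Proof.
apply: continuous_pair; apply: continuous_mx => b j; rewrite (ord1 b);
  under eq_fun do rewrite mxE.
- exact: xcoord_continuous.
- exact: zcoord_continuous.
Qed.

Lemma measurable_others (R : realType) n (i : 'I_n) :
  measurable_fun setT (@others R n i).
Proof. exact: (continuous_borel_map (@others_continuous R n i)). Qed.

Lemma measurable_admissible (R : realType) n :
  measurable [set w : borel (space2 R n) | forall j, 0 <= zcoord j w <= xcoord j w].
Proof.
rewrite (_ : [set _ | _] = \bigcap_(j : 'I_n)
  ([set: borel (space2 R n)] `&` [set w : borel (space2 R n) | 0 <= zcoord j w] `&`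
   ([set: borel (space2 R n)] `&` [set w : borel (space2 R n) | zcoord j w <= xcoord j w]))); last first.
  apply/seteqP; split=> [w /= H j _|w H j].
    by have /andP[] := H j.
  by have [//|[_ /= ->] [_ /= ->]] := H j.
apply: fin_bigcap_measurable => [|j _]; first exact: finite_finset.
by apply: measurableI; apply: measurable_fun_le => //; exact: measurable_funP.
Qed.

Section strategy_replacement.
Variables (R : realType) (n : nat) (i : 'I_n) (a : R * R -> R).
Hypotheses (ca : continuous a) (ma : measurable_fun setT a).
Hypothesis a_range : forall x z, 0 <= z <= x -> 0 <= a (x, z) <= x.

Local Notation tau := (borel_map (@replace_z_continuous R n i a ca)).

(** For risk [i] the new treaty is a function of [(X_i, Z_i)] and the other
    coordinates do not move.  For a risk [j <> i] it is the reverse: the moved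
    coordinates are among the others, on which the map acts on its own. *)
Lemma strategies_replace (muX : probability (borel 'rV[R]_n) R)
    (mu : probability (borel (space2 R n)) R) :
  strategies muX mu -> strategies muX (distribution mu tau).
Proof.
move=> [mu1 mu2 mu3]; split.
- by move=> B mB; rewrite -mu1.
- have mS : measurable [set w : borel (space2 R n) | forall j, 0 <= zcoord j w <= xcoord j w].
    exact: measurable_admissible.
  apply/eqP; rewrite eq_le probability_le1 //= -mu2.
  apply: le_measure; rewrite ?inE //.
    by rewrite -[X in measurable X]setTI; exact: (measurable_funP tau).
  move=> w /= H j; rewrite /zcoord /xcoord /replace_z /= mxE.
  by case: eqP => [->|_]; [exact: a_range (H i)|exact: H].
- move=> j; have [<-|ij] := eqVneq i j.
    apply: (@cond_indep_transport _ _ _ _ _ mu tau (xcoord i)) => //.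
    rewrite (_ : zcoord i \o tau = fun w => a (xcoord i w, zcoord i w)); last first.
      by apply/funext => w; rewrite /zcoord /= mxE eqxx.
    rewrite (_ : @others R n i \o tau = @others R n i); last first.
      by apply/funext => w; exact: others_replace_same.
    exact: (cond_indep_function (measurable_others i) (mu3 i) ma).
  apply: (@cond_indep_transport _ _ _ _ _ mu tau (xcoord j)) => //.
  rewrite (_ : zcoord j \o tau = zcoord j); last first.
    by apply/funext => w; rewrite /zcoord /= mxE eq_sym (negPf ij).
  case: (unliftP j i) ij => [l|->]; last by rewrite eqxx.
  move=> il _; rewrite (_ : @others R n j \o tau =
    (borel_map (@replace_z_continuous R n.-1 l a ca)) \o @others R n j); last first.
    by apply/funext => w; apply: others_replace_other; rewrite il liftK.
  exact: cond_indep_comp_right.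
Qed.
End strategy_replacement.

(** * Laws on the line *)

Lemma minr_continuous (R : realType) (T : topologicalType) (f g : T -> R) :
  continuous f -> continuous g -> continuous (fun x => Num.min (f x) (g x)).
Proof. by move=> cf cg x; exact: (continuous_min (cf x) (cg x)). Qed.

Lemma maxr_continuous (R : realType) (T : topologicalType) (f g : T -> R) :
  continuous f -> continuous g -> continuous (fun x => Num.max (f x) (g x)).
Proof. by move=> cf cg x; exact: (continuous_max (cf x) (cg x)). Qed.

Section ray_approximation.
Variable R : realType.
Implicit Types a x : R.

(** Continuous functions increasing to the indicator of [`]a, +oo[]. *)
Definition ray_approx a (m : nat) x : R := Num.min 1 (Num.max 0 (m%:R * (x - a))).

Lemma ray_approx_itv a m x : 0 <= ray_approx a m x <= 1.
Proof. by rewrite /ray_approx ge_min lexx /= le_min ler01 /= le_max lexx. Qed.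

Lemma ray_approx_continuous a m : continuous (ray_approx a m).
Proof.
apply: minr_continuous; first by move=> x; exact: cvg_cst.
apply: maxr_continuous => x; first exact: cvg_cst.
apply: cvgM; first exact: cvg_cst.
by apply: cvgB; [exact: cvg_id|exact: cvg_cst].
Qed.

Lemma ray_approx_cvg a x :
  ray_approx a m x @[m --> \oo] --> (\1_(`]a, +oo[%classic) x : R).
Proof.
rewrite indicE; case: (ltP a x) => ax.
  rewrite mem_set /=; last by rewrite in_itv /= ax.
  apply: cvg_near_cst; have xa : 0 < x - a by rewrite subr_gt0.
  near=> m.
  have mx : 1 <= m%:R * (x - a).
    rewrite -ler_pdivrMr // mul1r.
    by near: m; exact: nbhs_infty_ger.
  by rewrite /ray_approx max_r ?min_l // (le_trans ler01).
rewrite memNset /=; last by rewrite in_itv /= andbT ltNge ax.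
apply: cvg_near_cst; near=> m; rewrite /ray_approx.
by rewrite max_l ?min_r // mulr_ge0_le0 // subr_le0.
Unshelve. all: by end_near. Qed.

End ray_approximation.

Lemma itv_bounded_fun (R : realType) (T : Type) (f : T -> R) :
  (forall x, 0 <= f x <= 1) -> bounded_fun f.
Proof.
move=> f01; exists 1; split; first exact: num_real.
move=> y y1 x _ /=; have /andP[f0 f1] := f01 x.
by rewrite ger0_norm // (le_trans f1) // ltW.
Qed.

Lemma Rintegral_indic d (T : measurableType d) (R : realType)
  (mu : {measure set T -> \bar R}) (A : set T) : measurable A ->
  \int[mu]_x (\1_A x : R) = fine (mu A).
Proof. by move=> mA; rewrite /Rintegral integral_indic // setIT. Qed.

(** Rays generate the Borel sets, and their indicators are limits of continuous
    functions. *)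
Lemma probability_eq_continuous (R : realType) (m1 m2 : probability R R) :
  (forall g : R -> R, continuous g -> (forall x, 0 <= g x <= 1) ->
    \int[m1]_x g x = \int[m2]_x g x) ->
  forall A, measurable A -> m1 A = m2 A.
Proof.
move=> m12.
have ray (m : probability R R) a :
    \int[m]_x ray_approx a n x @[n --> \oo] --> fine (m `]a, +oo[%classic).
  rewrite -Rintegral_indic //.
  apply: (@dominated_Rintegral _ _ _ m (ray_approx a) _ (fun=> 1) _ _ _ _ _).2 => //.
  - move=> n; apply: continuous_measurable_fun.
    exact: ray_approx_continuous.
  - by apply: nearW => x; exact: ray_approx_cvg.
  - apply: nearW => x n; have /andP[f0 f1] := ray_approx_itv a n x.
    by rewrite ger0_norm.
  - exact: finite_measure_integrable_cst.
apply: (@measure_unique _ R _ (@RGenOInfty.G R) (fun n => `]- n%:R, +oo[%classic)).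
- exact: RGenOInfty.measurableE.
- move=> _ _ [a ->] [b ->]; exists (Num.max a b).
  by apply/seteqP; split => x /=; rewrite !in_itv /= !andbT gt_max => /andP.
- by move=> n; exists (- n%:R).
- apply/seteqP; split => // x _.
  have [N HN] : exists N : nat, - x + 1 <= N%:R := filter_ex (nbhs_infty_ger (- x + 1)).
  by exists N => //=; rewrite in_itv /= andbT; lra.
- move=> _ [a ->].
  have H1 := ray m1 a; have H2 := ray m2 a.
  have H : fine (m1 `]a, +oo[%classic) = fine (m2 `]a, +oo[%classic).
    have E : (fun n => \int[m1]_x ray_approx a n x) = (fun n => \int[m2]_x ray_approx a n x).
      apply/funext => n; apply: m12 => [|x]; first exact: ray_approx_continuous.
      exact: ray_approx_itv.
    rewrite E in H1.
    by rewrite -(cvg_lim (@Rhausdorff R) H1) (cvg_lim (@Rhausdorff R) H2).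
  rewrite -[LHS]fineK; last exact: fin_num_measure.
  by rewrite H fineK //; exact: fin_num_measure.
- by move=> n; rewrite (le_lt_trans (probability_le1 _ _)) ?ltry.
Qed.

(** * Limits of strategies *)

Lemma closure_test (R : realType) (T : ptopologicalType)
    (S : set (weak_probability R T)) (f : T -> R) (r : R)
    (mu : probability (borel T) R) :
  continuous f -> bounded_fun f ->
  (forall nu : probability (borel T) R, S nu -> \int[nu]_w f w = r) ->
  closure S mu -> \int[mu]_w f w = r.
Proof.
move=> cf bf Sr clS; apply: contrapT => /eqP neq.
have : nbhs (mu : weak_probability R T)
    [set nu : weak_probability R T | \int[(nu : probability (borel T) R)]_w f w != r].
  have /= := @weak_test_continuous _ _ _ cf bf mu [set y | y != r]; apply.
  by apply: open_nbhs_nbhs; split => //; exact: open_neq.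
by move=> /clS [nu [/Sr nur /=]]; rewrite nur eqxx.
Qed.

Section closure_of_strategies.
Variables (R : realType) (n : nat) (muX : probability (borel 'rV[R]_n) R).
Variable mu : probability (borel (space2 R n)) R.
Hypothesis clmu : closure (strategies muX) mu.

(** The amount by which [z_j] leaves [[0, x_j]], truncated at 1, is a bounded
    continuous function of zero mean under every strategy, hence under [mu]. *)
Lemma closure_admissible :
  {ae mu, forall w, forall j, 0 <= zcoord j w <= xcoord j w}.
Proof.
suff H j : {ae mu, forall w, 0 <= zcoord j w <= xcoord j w}.
  exact: filter_forall H.
pose f (w : space2 R n) : R := Num.min 1
  (Num.max 0 (- w.2 0 j) + Num.max 0 (w.2 0 j - w.1 0 j)).
have f0 w : 0 <= Num.max 0 (- (w : space2 R n).2 0 j) + Num.max 0 (w.2 0 j - w.1 0 j).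
  by rewrite addr_ge0 // le_max lexx.
have f01 w : 0 <= f w <= 1 by rewrite /f ge_min lexx /= le_min ler01 f0.
have cf : continuous f.
  apply: minr_continuous; first by move=> w; exact: cvg_cst.
  have c0 : continuous (fun w : space2 R n => 0 : R) by move=> w; exact: cvg_cst.
  have cz := @zcoord_continuous R n j; have cx := @xcoord_continuous R n j.
  move=> w; apply: cvgD.
    by apply: (maxr_continuous c0) => {}w; apply: cvgN; exact: cz.
  apply: (maxr_continuous c0) => {}w; apply: cvgB; [exact: cz|exact: cx].
have bf := itv_bounded_fun f01.
have fE w : (f w == 0) = (0 <= zcoord j w <= xcoord j w).
  rewrite /f /zcoord /xcoord; apply/idP/idP.
    rewrite minEle; case: ifP => _; first by rewrite oner_eq0.
    rewrite paddr_eq0 ?le_max ?lexx // => /andP[].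
    by rewrite eq_le ge_max oppr_le0 => /andP[/andP[_ ->] _];
       rewrite eq_le ge_max subr_le0 => /andP[/andP[_ ->] _].
  move=> /andP[z0 zx]; rewrite max_l ?oppr_le0 // max_l ?subr_le0 // addr0.
  by rewrite min_r.
have int0 : \int[mu]_w f w = 0.
  apply: (closure_test cf bf _ clmu) => nu [_ nu1 _].
  rewrite -(Rintegral_probability_cst nu 0); apply: ae_eq_Rintegral => //.
    exact: (continuous_borel_measurable cf).
  exists (~` [set w | forall i, 0 <= zcoord i w <= xcoord i w]); split.
  - by apply: measurableC; exact: measurable_admissible.
  - apply: (etrans (probability_setC nu (@measurable_admissible R n))).
    by rewrite [X in (1 - X)%E]nu1 subee.
  - by move=> w /= fw0 adm; apply: fw0; apply/eqP; rewrite fE.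
have f_ge0 : {ae mu, forall w, 0 <= f w} by apply: nearW => w; case/andP: (f01 w).
have := Rintegral_eq0_ae (bounded_continuous_integrable mu cf bf) f_ge0 int0.
by apply: filterS => w /eqP; rewrite fE.
Qed.

Lemma closure_marginal (j : 'I_n) (A : set R) : measurable A ->
  distribution mu (xcoord j) A = distribution muX (component j) A.
Proof.
apply: probability_eq_continuous => g cg g01.
have mg : measurable_fun setT g by exact: continuous_measurable_fun.
rewrite !Rintegral_distribution //.
have cgx : continuous (fun w : space2 R n => g (w.1 0 j)).
  move=> w; apply: (@continuous_comp _ _ _ (fun w : space2 R n => w.1 0 j) g).
    exact: xcoord_continuous.
  exact: cg.
apply: (closure_test cgx _ _ clmu).
  by apply: itv_bounded_fun => w; exact: g01.
move=> nu [nu1 _ _].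
pose p1 : {mfun borel (space2 R n) >-> borel 'rV[R]_n} :=
  borel_map (@fst_continuous 'rV[R]_n 'rV[R]_n).
transitivity (\int[distribution nu p1]_x g (component j x)).
  by rewrite Rintegral_distribution //; exact: measurableT_comp.
by rewrite /Rintegral; congr fine; apply: eq_measure_integral => B mB _; exact: nu1.
Qed.

End closure_of_strategies.

(** * Continuous functions detect signs *)

Section continuous_tests.
Variables (R : realType) (mu : probability R R) (f : R -> R).
Hypothesis sf : mu.-integrable setT (EFin \o f).

Let mf : measurable_fun setT f.
Proof. by apply/measurable_EFinP; exact: measurable_int sf. Qed.

Let test_fun (h : R -> R) := continuous h /\ forall x, 0 <= h x <= 1.

Let summableM (h : R -> R) (M : R) : measurable_fun setT h ->
  (forall x, `|h x| <= M) -> mu.-integrable setT (EFin \o (fun x => h x * f x)).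
Proof.
move=> mh h1; apply: (@ae_le_integrable _ _ _ _ _ (fun x => M * `|f x|)).
- exact: measurable_funM.
- by apply: nearW => x; rewrite normrM ler_wpM2r.
- exact: (integrableZl measurableT M (integrable_norm sf)).
Qed.

Let dist (h g : R -> R) := \int[mu]_x (`|h x - g x| * `|f x|).

Let summable_dist (h g : R -> R) : measurable_fun setT h -> measurable_fun setT g ->
  (forall x, 0 <= h x <= 1) -> (forall x, 0 <= g x <= 1) ->
  mu.-integrable setT (EFin \o (fun x => `|h x - g x| * `|f x|)).
Proof.
move=> mh mg h01 g01.
apply: (@ae_le_integrable _ _ _ _ _ (fun x => `|f x|)); last exact: integrable_norm.
- apply: measurable_funM; apply: measurableT_comp => //.
  exact: measurable_funB.
- apply: nearW => x; rewrite normrM !normr_id ler_piMl //.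
  by have := h01 x; have := g01 x; rewrite ler_norml; lra.
Qed.

Let indic01 (A : set R) x : 0 <= (\1_A x : R) <= 1.
Proof. by rewrite indicE; case: (x \in A); rewrite /= ?lexx ler01. Qed.

Let approximable (A : set R) := forall e, 0 < e ->
  exists2 h, test_fun h & dist h (\1_A) < e.

Let test_measurable h : test_fun h -> measurable_fun setT h.
Proof. by move=> [ch _]; exact: continuous_measurable_fun. Qed.

Let dist_cvg0 (h_ : nat -> R -> R) (g : R -> R) :
  (forall n, measurable_fun setT (h_ n)) -> measurable_fun setT g ->
  (forall n x, 0 <= h_ n x <= 1) -> (forall x, 0 <= g x <= 1) ->
  (forall x, h_ n x @[n --> \oo] --> g x) ->
  dist (h_ n) g @[n --> \oo] --> 0.
Proof.
move=> mh mg h01 g01 hg; rewrite -(Rintegral_probability_cst mu 0).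
apply: (@dominated_Rintegral _ _ _ mu _ (fun=> 0) (fun x => `|f x|) _ _ _ _ _).2 => //.
- move=> n; apply: measurable_funM; apply: measurableT_comp => //.
  exact: measurable_funB.
- apply: nearW => x; rewrite -(mul0r `|f x|); apply: cvgMr_tmp.
  rewrite -(normr0 R) -(subrr (g x)).
  by apply: cvg_norm; apply: cvgB; [exact: hg|exact: cvg_cst].
- apply: nearW => x n; rewrite normrM !normr_id ler_piMl //.
  by have := h01 n x; have := g01 x; rewrite ler_norml; lra.
- exact: integrable_norm.
Qed.

Let dist_lt (h_ : nat -> R -> R) (g : R -> R) e : 0 < e ->
  dist (h_ n) g @[n --> \oo] --> 0 -> exists n, dist (h_ n) g < e.
Proof.
move=> e0 /(@cvgr_lt _ _ _ _ _ 0)/(_ e e0) H.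
by have [n Hn] := filter_ex H; exists n.
Qed.

Let dist_triangle (h g k : R -> R) :
  measurable_fun setT h -> measurable_fun setT g -> measurable_fun setT k ->
  (forall x, 0 <= h x <= 1) -> (forall x, 0 <= g x <= 1) -> (forall x, 0 <= k x <= 1) ->
  dist h k <= dist h g + dist g k.
Proof.
move=> mh mg mk h01 g01 k01; rewrite /dist -RintegralD //; [|exact: summable_dist..].
apply: ae_le_Rintegral; first exact: summable_dist.
  have := integrableD measurableT (summable_dist mh mg h01 g01) (summable_dist mg mk g01 k01).
  by [].
by apply: nearW => x; rewrite -mulrDl ler_wpM2r // ler_distD.
Qed.

Let approximable_limit (A_ : nat -> set R) (A : set R) :
  (forall n, measurable (A_ n)) -> measurable A ->
  (forall x, (\1_(A_ n) x : R) @[n --> \oo] --> (\1_A x : R)) ->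
  (forall n, approximable (A_ n)) -> approximable A.
Proof.
move=> mA_ mA A_A apA e e0.
have e2 : 0 < e / 2 by rewrite divr_gt0.
have [n Hn] : exists n, dist (\1_(A_ n)) (\1_A) < e / 2.
  by apply: dist_lt => //; apply: dist_cvg0.
have [h th Hh] := apA n _ e2; exists h => //.
rewrite [ltRHS]splitr; apply: le_lt_trans (ltrD Hh Hn).
by apply: dist_triangle => //; [exact: test_measurable|case: th].
Qed.

Let approximable_ray a : approximable `]a, +oo[%classic.
Proof.
move=> e e0.
have [n Hn] : exists n, dist (ray_approx a n) (\1_(`]a, +oo[%classic)) < e.
  apply: dist_lt => //; apply: dist_cvg0 => //.
  - by move=> n; apply: continuous_measurable_fun; exact: ray_approx_continuous.
  - by move=> n x; exact: ray_approx_itv.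
  - exact: ray_approx_cvg.
exists (ray_approx a n) => //; split; first exact: ray_approx_continuous.
exact: ray_approx_itv.
Qed.

Let approximableC A : approximable A -> approximable (~` A).
Proof.
move=> apA e /apA [h [ch h01] He]; exists (fun x => 1 - h x).
  split=> [x|x]; last by have := h01 x; lra.
  by apply: cvgB; [exact: cvg_cst|exact: ch].
rewrite (_ : dist _ _ = dist h \1_A) //; congr Rintegral; apply/funext => x.
congr (_ * _); rewrite !indicE in_setC; case: (x \in A) => /=; last first.
  by rewrite subr0 distrC; congr (`|_|); ring.
by rewrite subr0 distrC.
Qed.

Let approximableU A B : measurable A -> measurable B ->
  approximable A -> approximable B -> approximable (A `|` B).
Proof.
move=> mA mB apA apB e e0; have e2 : 0 < e / 2 by rewrite divr_gt0.
have [h th Hh] := apA _ e2; have [g tg Hg] := apB _ e2.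
have [ch h01] := th; have [cg g01] := tg.
have max01 x : 0 <= Num.max (h x) (g x) <= 1.
  by have := h01 x; have := g01 x; rewrite le_max ge_max; lra.
have tm : test_fun (fun x => Num.max (h x) (g x)).
  by split=> //; exact: maxr_continuous.
exists (fun x => Num.max (h x) (g x)) => //.
rewrite [ltRHS]splitr; apply: le_lt_trans (ltrD Hh Hg).
have mh := test_measurable th; have mg := test_measurable tg.
have mm := test_measurable tm.
have mIA : measurable_fun setT (\1_A : R -> R) by exact: measurable_indic.
have mIB : measurable_fun setT (\1_B : R -> R) by exact: measurable_indic.
have mIAB : measurable_fun setT (\1_(A `|` B) : R -> R).
  by apply: measurable_indic; exact: measurableU.
have sA := summable_dist mh mIA h01 (indic01 A).
have sB := summable_dist mg mIB g01 (indic01 B).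
have sAB := summable_dist mm mIAB max01 (indic01 (A `|` B)).
rewrite /dist -RintegralD //; apply: ae_le_Rintegral => //.
  exact: (integrableD measurableT sA sB).
apply: nearW => x; rewrite -mulrDl ler_wpM2r // !indicE in_setU.
have := h01 x; have := g01 x => /andP[g0 g1] /andP[h0 h1].
case: (x \in A); case: (x \in B); case: (leP (h x) (g x)) => hg /=;
  rewrite ?subr0 ?(distrC _ 1) ?(distrC _ 1) ?(distrC _ 1) ?ger0_norm ?subr_ge0 //; lra.
Qed.

Let approximable_borel A : measurable A -> approximable A.
Proof.
move=> mA; have : (@RGenOInfty.G R).-sigma.-measurable A.
  by rewrite -RGenOInfty.measurableE.
move: A {mA}; apply: dynkin_induction.
- exact: RGenOInfty.measurableE.
- move=> _ _ [a ->] [b ->]; exists (Num.max a b).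
  by apply/seteqP; split => x /=; rewrite !in_itv /= !andbT gt_max => /andP.
- move=> e e0; exists (fun=> 1); first by split=> x; [exact: cvg_cst|rewrite ler01 lexx].
  rewrite (_ : dist _ _ = 0) // -(Rintegral_probability_cst mu 0).
  by congr Rintegral; apply/funext => x; rewrite indicE in_setT subrr normr0 mul0r.
- by move=> _ [a ->]; exact: approximable_ray.
- by move=> S _; exact: approximableC.
- move=> F mF _ apF.
  have mU n : measurable (\bigcup_(i < n) F i) by exact: fin_bigcup_measurable.
  apply: (@approximable_limit (fun n => \bigcup_(i < n) F i)) => //.
  + exact: bigcup_measurable.
  + move=> x; apply: cvg_near_cst; rewrite !indicE.
    have [[m _ Fx]|nFx] := pselect ((\bigcup_k F k) x).
      near=> n; rewrite indicE; have -> : x \in \bigcup_(i < n) F i.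
        by apply: mem_set; exists m => //=; near: n; exact: nbhs_infty_gt.
      by rewrite mem_set //; exists m.
    apply: nearW => n; rewrite indicE; have -> : (x \in \bigcup_(i < n) F i) = false.
      by apply: memNset => -[m _ Fx]; apply: nFx; exists m.
    by rewrite memNset.
  + elim=> [|n IHn].
      rewrite bigcup_mkord big_ord0 -setCT; apply: approximableC => e e0.
      exists (fun=> 1); first by split=> x; [exact: cvg_cst|rewrite ler01 lexx].
      rewrite (_ : dist _ _ = 0) // -(Rintegral_probability_cst mu 0).
      by congr Rintegral; apply/funext => x; rewrite indicE in_setT subrr normr0 mul0r.
    rewrite bigcup_mkord big_ord_recr /= -bigcup_mkord.
    exact: approximableU.
Unshelve. all: by end_near. Qed.

(** Continuous functions approximate the indicator of [f > 0] in the weighted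
    space [L1(|f| mu)], so that they detect the sign of [f]. *)
Lemma ae_le0_continuous_tests :
  (forall h : R -> R, continuous h -> (forall x, 0 <= h x <= 1) ->
    \int[mu]_x (h x * f x) <= 0) ->
  {ae mu, forall x, f x <= 0}.
Proof.
move=> tests; pose A := [set x | 0 < f x].
have mA : measurable A.
  rewrite (_ : A = setT `&` f @^-1` `]0, +oo[%classic); last first.
    by rewrite setTI; apply/seteqP; split => x /=; rewrite in_itv /= andbT.
  by apply: mf => //; exact: measurable_itv.
have mI : measurable_fun setT (\1_A : R -> R) by exact: measurable_indic.
have sI : mu.-integrable setT (EFin \o (fun x => \1_A x * f x)).
  apply: (@summableM _ 1) => // x.
  by have /andP[i0 i1] := indic01 A x; rewrite ger0_norm.
have I0 : {ae mu, forall x, 0 <= \1_A x * f x}.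
  apply: nearW => x; rewrite indicE; have [xA|xA] := boolP (x \in A).
    by rewrite mul1r ltW //; move: xA; rewrite inE.
  by rewrite mul0r.
have : \int[mu]_x (\1_A x * f x) <= 0.
  apply/ler_addgt0Pr => e e0; rewrite add0r.
  have [h th He] := approximable_borel mA e0; have [ch h01] := th.
  have mh := test_measurable th.
  have sh : mu.-integrable setT (EFin \o (fun x => h x * f x)).
    apply: (@summableM _ 1) => // x.
    by have /andP[i0 i1] := h01 x; rewrite ger0_norm.
  have sd := summable_dist mh mI h01 (indic01 A).
  apply: (@le_trans _ _ (\int[mu]_x (h x * f x) + dist h \1_A)).
    rewrite /dist -RintegralD //; apply: ae_le_Rintegral => //.
      exact: (integrableD measurableT sh sd).
    apply: nearW => x; rewrite -lerBlDl -mulrBl.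
    by apply: le_trans (ler_norm _) _; rewrite normrM distrC.
  by rewrite -[leRHS]add0r lerD // ?tests // ltW.
move=> I1; have /Rintegral_eq0_ae : \int[mu]_x (\1_A x * f x) = 0.
  by apply/eqP; rewrite eq_le I1 Rintegral_ge0_ae //; exact: measurable_funM.
move=> /(_ sI I0); apply: filterS => x; rewrite indicE leNgt.
have [xA|xA _] := boolP (x \in A); last by apply: contraNN xA => fx; rewrite inE.
by rewrite mul1r => ->; rewrite ltxx.
Qed.

End continuous_tests.

(** * Disintegration along a regular conditional law *)

Section graph_kernel.
Context d1 (T1 : measurableType d1) (R : realType) (Q : R.-pker R ~> T1).

(** The kernel sending [x] to the product of [delta_x] and [Q x], with a dummy
    parameter to fit kernel composition. *)
Definition graph_kernel (p : unit * R) (F : set (R * T1)) : \bar R :=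
  pushforward (Q p.2) (pair p.2) F.

Let mpair (x : R) : measurable_fun setT (pair x : T1 -> R * T1).
Proof. exact: measurable_pair1. Qed.

Let graph_kernel0 p : graph_kernel p set0 = 0%E.
Proof. by rewrite /graph_kernel /pushforward preimage_set0 measure0. Qed.

Let graph_kernel_ge0 p F : (0 <= graph_kernel p F)%E.
Proof. exact: measure_ge0. Qed.

Let graph_kernel_sigma_additive p : semi_sigma_additive (graph_kernel p).
Proof.
move=> F mF tF mUF; rewrite /graph_kernel /pushforward preimage_bigcup.
have mpF n : measurable (pair p.2 @^-1` F n).
  by rewrite -[X in measurable X]setTI; exact: mpair.
apply: measure_semi_sigma_additive => //.
- apply/trivIsetP => i j _ _ ij; rewrite -preimage_setI.
  by move/trivIsetP : tF => /(_ _ _ I I ij) ->; rewrite preimage_set0.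
- exact: bigcup_measurable.
Qed.

HB.instance Definition _ p := isMeasure.Build _ _ _ (graph_kernel p)
  (graph_kernel0 p) (graph_kernel_ge0 p) (@graph_kernel_sigma_additive p).

Definition mgraph_kernel (p : unit * R) : {measure set (R * T1) -> \bar R} :=
  graph_kernel p.

Lemma graph_kernel_measurable F : measurable F ->
  measurable_fun [set: unit * R] (mgraph_kernel ^~ F).
Proof.
move=> mF; rewrite (_ : mgraph_kernel ^~ F = (fun x => Q x (xsection F x)) \o snd).
  apply: measurableT_comp => //.
  by apply: measurable_fun_xsection_finite_kernel; rewrite inE.
apply/funext => p /=; rewrite /mgraph_kernel /= /graph_kernel /pushforward.
by rewrite xsectionE.
Qed.

HB.instance Definition _ := isKernel.Build _ _ _ _ _ mgraph_kernel
  graph_kernel_measurable.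

Let graph_kernel_prob p : mgraph_kernel p setT = 1%E.
Proof. by rewrite /mgraph_kernel /= /graph_kernel /pushforward preimage_setT prob_kernel. Qed.

HB.instance Definition _ := Kernel_isProbability.Build _ _ _ _ _
  mgraph_kernel graph_kernel_prob.

End graph_kernel.

Section disintegration.
Context d (T : measurableType d) (R : realType) (nu : probability T R).
Context d1 (T1 : measurableType d1).
Variables (Y : {mfun T >-> R}) (V : T -> T1) (Q : R.-pker R ~> T1).
Hypotheses (mV : measurable_fun setT V) (Q_law : is_regular_cond_law nu Y V Q).
Local Notation law := (distribution nu Y).

Let J w : R * T1 := (Y w, V w).
Let mJ : measurable_fun setT J.
Proof. by apply: measurable_fun_pair. Qed.

Lemma regular_cond_law_set F : measurable F ->
  (nu (J @^-1` F) = \int[law]_x Q x (xsection F x))%E.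
Proof.
have mQ G : measurable G -> measurable_fun setT (fun x => Q x (xsection G x)).
  by move=> mG; apply: measurable_fun_xsection_finite_kernel; rewrite inE.
have mJF G : measurable G -> measurable (J @^-1` G).
  by move=> mG; rewrite -[X in measurable X]setTI; exact: mJ.
move=> mF; rewrite measurable_prod_measurableType in mF.
move: F mF; apply: dynkin_induction.
- exact: measurable_prod_measurableType.
- move=> _ _ [A mA [B' mB' <-]] [C mC [D mD <-]].
  by rewrite -setXI; exists (A `&` C); [exact: measurableI|exists (B' `&` D) => //; exact: measurableI].
- rewrite preimage_setT probability_setT.
  rewrite (eq_integral (cst 1%E)) => [|y _].
    by rewrite integral_cst // mul1e; exact/esym/(probability_setT law).
  rewrite (_ : xsection setT y = setT) ?prob_kernel //.
  by apply/seteqP; split => v; rewrite /= xsectionE.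
- move=> _ [C mC [B mB <-]]; rewrite -[LHS]/(nu (Y @^-1` C `&` V @^-1` B)) Q_law //.
  rewrite integral_mkcond; apply: eq_integral => y _; rewrite patchE.
  case: ifPn => yC; first by rewrite in_xsectionX.
  by rewrite notin_xsectionX // measure0.
- move=> S mS ES; rewrite preimage_setC.
  have mSC := measurableC mS.
  have fin : nu (J @^-1` S) \is a fin_num by apply: fin_num_measure; exact: mJF.
  have E1 : (1 = nu (J @^-1` S) + nu (~` (J @^-1` S)))%E.
    rewrite probability_setC; last exact: mJF.
    by rewrite addeC subeK.
  have E2 : (1 = \int[law]_x Q x (xsection S x) + \int[law]_x Q x (xsection (~` S) x))%E.
    rewrite -ge0_integralD //; [|exact: mQ|exact: mQ].
    rewrite (eq_integral (cst 1%E)) => [|y _].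
      by rewrite integral_cst // mul1e; exact/esym/(probability_setT law).
    rewrite (_ : xsection (~` S) y = ~` (xsection S y)); last first.
      by apply/seteqP; split => v; rewrite /= !xsectionE.
    have mSy : measurable (xsection S y) by exact: measurable_xsection.
    rewrite -measureU ?setICr //; last exact: measurableC.
    by rewrite setUv; exact: prob_kernel.
  transitivity (1 - nu (J @^-1` S))%E.
    by rewrite [in RHS]E1 [X in _ = (X - _)%E]addeC addeK.
  by rewrite [in LHS]E2 -ES [X in (X - _)%E = _]addeC addeK.
- move=> F mF tF EF; rewrite preimage_bigcup.
  rewrite measure_bigcup //=; last 2 first.
  + by move=> n _; exact: mJF.
  + apply/trivIsetP => i j _ _ ij; rewrite -preimage_setI.
    by move/trivIsetP : tF => /(_ _ _ I I ij) ->; rewrite preimage_set0.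
  transitivity (\sum_(0 <= n <oo) \int[law]_x Q x (xsection (F n) x))%E.
    transitivity (\sum_(0 <= n <oo) nu (J @^-1` F n))%E.
      by apply: eq_eseriesl => n; rewrite in_setT.
    by apply: eq_eseriesr => n _; exact: EF.
  rewrite -integral_nneseries //; last by move=> n; exact: mQ.
  apply: eq_integral => x _; rewrite xsection_bigcup measure_bigcup //=.
  + by apply: eq_eseriesl => n; rewrite in_setT.
  + by move=> n _; exact: measurable_xsection.
  + exact: trivIset_xsection.
Qed.

Lemma regular_cond_law_integral (phi : R * T1 -> \bar R) :
  measurable_fun setT phi -> (forall p, 0 <= phi p)%E ->
  (\int[nu]_w phi (Y w, V w) = \int[law]_x \int[Q x]_v phi (x, v))%E.
Proof.
move=> mphi phi0.
pose l : unit -> pprobability R R := cst (law : pprobability R R).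
pose k := kprobability (measurable_cst _ : measurable_fun setT l).
transitivity (\int[pushforward nu J]_p phi p)%E.
  by rewrite ge0_integral_pushforward.
transitivity (\int[kcomp k (mgraph_kernel Q) tt]_p phi p)%E.
  apply: eq_measure_integral => F mF _; 
  apply: (etrans (regular_cond_law_set mF)); apply: eq_integral => x _.
  by rewrite xsectionE.
rewrite integral_kcomp //; apply: eq_integral => x _.
rewrite -[LHS]/(\int[pushforward (Q x) (pair x)]_p phi p)%E.
by rewrite ge0_integral_pushforward.
Qed.

End disintegration.

(** * Payoffs, and moves constrained to an interval *)

(** Truncating at [c] gives an integrand that is measurable on the whole space,
    whatever the values of [phi] beyond [c]. *)
Lemma expect_truncate (R : realType) (c : R) d (T : measurableType d)
    (mu : probability T R) (phi : R -> R) (L : T -> R) :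
  measurable_fun setT L ->
  measurable_fun setT (fun y : R => phi (Num.min y c)) ->
  {ae mu, forall w, L w <= c} ->
  expect c mu phi L = (\int[mu]_w (phi (Num.min (L w) c))%:E)%E.
Proof.
move=> mL mphi Lc; rewrite /expect integral_mkcond.
have mD : measurable [set w | L w <= c].
  rewrite (_ : [set _ | _] = setT `&` [set w | L w <= cst c w]); last by rewrite setTI.
  by apply: measurable_fun_le => //; exact: measurable_cst.
have mphiL : measurable_fun setT (fun w => (phi (Num.min (L w) c))%:E).
  by apply/measurable_EFinP; exact: (measurableT_comp mphi mL).
have E : (fun w => (phi (L w))%:E) \_ [set w | L w <= c] =
    (fun w => (phi (Num.min (L w) c))%:E) \_ [set w | L w <= c].
  apply/funext => w; rewrite !patchE; case: ifPn => //; rewrite inE /= => Lw.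
  by rewrite min_l.
rewrite E; apply: ae_eq_integral => //.
  by apply/(measurable_restrictT _ mD); exact: measurable_funTS.
by apply: filterS Lc => w Lw _; rewrite patchE mem_set.
Qed.

Lemma bounded_above_integrable (R : realType) d (T : measurableType d)
    (mu : probability T R) (f : T -> R) (M : R) :
  measurable_fun setT f -> (forall w, f w <= M) ->
  (-oo < \int[mu]_w (f w)%:E)%E -> mu.-integrable setT (EFin \o f).
Proof.
move=> mf fM If.
have mfE : measurable_fun setT (EFin \o f) by exact/measurable_EFinP.
have sp : mu.-integrable setT ((EFin \o f)^\+)%E.
  apply: (@le_integrable _ _ _ _ _ _ _ (fun=> (Num.max M 0)%:E)) => //.
  - exact: measurable_funepos.
  - move=> w _; rewrite gee0_abs // funeposE /= -EFin_max lee_fin ger0_norm.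
      by rewrite ge_max !le_max fM lexx !orbT.
    by rewrite le_max lexx orbT.
  - exact: finite_measure_integrable_cst.
have sn : mu.-integrable setT ((EFin \o f)^\-)%E.
  apply/integrableP; split; first exact: measurable_funeneg.
  under eq_integral do rewrite gee0_abs //.
  rewrite ltNge leye_eq; apply/negP => /eqP Iy.
  by move: If; rewrite integralE Iy /= addeNy ?ltxx //; case: (X in X != _).
rewrite (funeposneg (EFin \o f)); exact: integrableB.
Qed.

Section payoff_bounds.
Variables (R : realType) (n : nat) (k : 'I_n -> nat).
Variables (Psi : forall j, 'rV[R]_(k j) -> R) (c : R).
Hypothesis Psi_ge0 : forall j (u : 'rV_(k j)), orthant u -> 0 <= Psi u.
Implicit Type mu : probability (borel (space2 R n)) R.

Lemma premium_ge0 mu j : {ae mu, forall w, 0 <= zcoord j w} -> 0 <= premium Psi mu j.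
Proof.
move=> z0; apply: Psi_ge0 => l; rewrite mxE; apply: Rintegral_ge0_ae.
  exact: measurable_funX.
by apply: filterS z0 => w; exact: exprn_ge0.
Qed.

Lemma payoff_le mu w : (forall j, 0 <= premium Psi mu j) ->
  (forall j, zcoord j w <= xcoord j w) -> payoff Psi c mu w <= c.
Proof.
move=> P0 zx; rewrite /payoff gerBl; apply: sumr_ge0 => j _.
by rewrite -addrA addr_ge0 // subr_ge0.
Qed.

Lemma payoff_measurable mu : measurable_fun setT (payoff Psi c mu).
Proof.
apply: measurable_funB; first exact: measurable_cst.
apply: measurable_sum => j; apply: measurable_funB => //.
by apply: measurable_funD.
Qed.

End payoff_bounds.

Section clamp.
Variable R : realType.
Implicit Types s t x z : R.

Definition clamp x y : R := Num.max 0 (Num.min x y).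

(** Right derivative at [s = 0] of [s |-> clamp x (z + s t)]: the constraint
    [0 <= z <= x] only blocks a move that leaves the interval. *)
Definition clamp_rate t x z : R :=
  if 0 <= t then (if z < x then t else 0) else (if 0 < z then t else 0).

Lemma clamp_itv x y : 0 <= x -> 0 <= clamp x y <= x.
Proof. by move=> x0; rewrite /clamp le_max lexx ge_max x0 ge_min lexx. Qed.

Lemma clamp_dist s t x z : 0 <= s -> `|t| <= 1 -> 0 <= z <= x ->
  `|clamp x (z + s * t) - z| <= s.
Proof.
move=> s0; rewrite ler_norml => /andP[t1 t2] /andP[z0 zx].
have st1 : s * t <= s by nra.
have st2 : - s <= s * t by nra.
rewrite /clamp ler_distl.
case: (leP x (z + s * t)) => H; case: (leP 0 _) => H'; lra.
Qed.

Lemma clamp_rate_le t x z : `|clamp_rate t x z| <= `|t|.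
Proof. by rewrite /clamp_rate; repeat case: ifP => _; rewrite ?normr0. Qed.

Lemma clamp_cvg (s : nat -> R) t x z :
  (forall m, 0 < s m) -> s @ \oo --> 0 -> 0 <= z <= x ->
  (s m)^-1 * (clamp x (z + s m * t) - z) @[m --> \oo] --> clamp_rate t x z.
Proof.
move=> s0 s_0 /andP[z0 zx]; rewrite /clamp_rate.
have small e : 0 < e -> \forall m \near \oo, s m * `|t| <= e.
  move=> e0.
  have : s m * `|t| @[m --> \oo] --> 0 * `|t| by exact: cvgMr_tmp.
  by rewrite mul0r => /(@cvgr_le _ _ _ _ _ 0)/(_ e e0).
have move_t m : clamp x (z + s m * t) = z + s m * t ->
    (s m)^-1 * (clamp x (z + s m * t) - z) = t.
  by move=> ->; rewrite addrC addKr mulKf // gt_eqF.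
have [t0|t0] := leP 0 t.
  have st m : 0 <= s m * t by rewrite mulr_ge0 // ltW.
  case: ltP => [zx'|xz]; apply: cvg_near_cst.
    have := small (x - z); rewrite subr_gt0 zx' ger0_norm // => /(_ erefl).
    apply: filterS => m Hm; apply: move_t; have := st m.
    by rewrite /clamp => ?; rewrite min_r ?max_r //; lra.
  apply: nearW => m; have := st m => stm.
  by rewrite /clamp min_l ?max_r ?(le_anti (introT andP (conj zx xz))) ?subrr ?mulr0 //; lra.
have st m : s m * t <= 0 by rewrite mulr_ge0_le0 // ltW.
case: ltP => [z0'|z0']; apply: cvg_near_cst.
  have := small z z0'; rewrite ltr0_norm //.
  apply: filterS => m Hm; apply: move_t; have := st m.
  by rewrite /clamp => ?; rewrite min_r ?max_r //; lra.
apply: nearW => m; have := st m => stm.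
have -> : z = 0 by apply: le_anti; rewrite z0 z0'.
by rewrite /clamp add0r min_r ?max_l ?subrr ?mulr0 //; lra.
Qed.

End clamp.

(** * Rates of change of moments and premium *)

Section perturbed_moments.
Context d (T : measurableType d) (R : realType) (P : probability T R).
Variables (k : nat) (X Z t : T -> R).
Hypotheses (mX : measurable_fun setT X) (mZ : measurable_fun setT Z)
           (mt : measurable_fun setT t).
Hypothesis Z_itv : {ae P, forall w, 0 <= Z w <= X w}.
Hypothesis t_le1 : forall w, `|t w| <= 1.
Hypothesis X_moment : P.-integrable setT (EFin \o (fun w => X w ^+ k)).

Local Notation Zs s := (fun w => clamp (X w) (Z w + s * t w)).
Local Notation rate := (fun w => clamp_rate (t w) (X w) (Z w)).
Local Notation moments Y := (\row_(l < k) \int[P]_w (Y w ^+ l.+1)).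

Lemma perturbed_measurable (s : R) : measurable_fun setT (Zs s).
Proof.
apply: measurable_maxr; first exact: measurable_cst.
apply: measurable_minr => //; apply: measurable_funD => //.
by apply: measurable_funM => //; exact: measurable_cst.
Qed.

Lemma rate_measurable : measurable_fun setT rate.
Proof.
have m0 : measurable_fun setT (fun _ : T => 0 : R) by exact: measurable_cst.
rewrite /clamp_rate; apply: measurable_fun_ifT; first by apply: measurable_fun_ler.
  by apply: measurable_fun_ifT => //; apply: measurable_fun_ltr.
by apply: measurable_fun_ifT => //; apply: measurable_fun_ltr.
Qed.

Lemma perturbed_itv (s : R) : {ae P, forall w, 0 <= Zs s w <= X w}.
Proof.
by apply: filterS Z_itv => w /andP[z0 zx]; apply: clamp_itv; exact: le_trans zx.
Qed.

Lemma moment_integrable (Y : T -> R) p : (p <= k)%N -> measurable_fun setT Y ->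
  {ae P, forall w, 0 <= Y w <= X w} ->
  P.-integrable setT (EFin \o (fun w => Y w ^+ p)).
Proof.
move=> pk mY Y0; apply: (@ae_le_integrable _ _ _ _ _ (fun w => 1 + X w ^+ k)).
- exact: measurable_funX.
- apply: filterS Y0 => w /andP[y0 yx]; rewrite ger0_norm ?exprn_ge0 //.
  have x0 := le_trans y0 yx.
  apply: (le_trans (lerXn2r p _ _ yx)); rewrite ?nnegrE //.
  have [x1|/ltW x1] := leP (X w) 1.
    by rewrite (le_trans (exprn_ile1 p x0 x1)) // lerDl exprn_ge0.
  by rewrite (le_trans (ler_weXn2l x1 pk)) // lerDr.
- apply: (@integrableD _ _ _ _ _ measurableT (EFin \o (fun=> 1)) _ _ X_moment).
  exact: finite_measure_integrable_cst.
Qed.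

Lemma perturbed_cvg (s : nat -> R) w :
  (forall m, 0 < s m) -> s @ \oo --> 0 -> 0 <= Z w <= X w ->
  Zs (s m) w @[m --> \oo] --> Z w.
Proof.
move=> s0 s_0 zx; apply/cvgrPdist_le => e e0.
have H : \forall m \near \oo, s m <= e by exact: (cvgr_le _ s_0).
apply: filterS H => m sm.
by rewrite distrC (le_trans (clamp_dist (ltW (s0 m)) (t_le1 w) zx)).
Qed.

(** Dominated convergence: a clamped move of size at most [s] changes a power
    of exponent [l.+1] by at most [s l.+1 X^l]. *)
Lemma moment_rate (s : nat -> R) l : (l < k)%N ->
  (forall m, 0 < s m) -> s @ \oo --> 0 ->
  (s m)^-1 * (\int[P]_w (Zs (s m) w ^+ l.+1) - \int[P]_w (Z w ^+ l.+1))
    @[m --> \oo] --> l.+1%:R * \int[P]_w (Z w ^+ l * rate w).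
Proof.
move=> lk s0 s_0.
have X_itv : {ae P, forall w, 0 <= X w <= X w}.
  by apply: filterS Z_itv => w /andP[z0 zx]; rewrite lexx (le_trans z0).
have iZ := moment_integrable lk mZ Z_itv.
have iZs m := moment_integrable lk (perturbed_measurable (s m)) (perturbed_itv (s m)).
have irate : P.-integrable setT (EFin \o (fun w => Z w ^+ l * rate w)).
  apply: (@ae_le_integrable _ _ _ _ _ (fun w => Z w ^+ l)).
  - by apply: measurable_funM; [exact: measurable_funX|exact: rate_measurable].
  - apply: filterS Z_itv => w /andP[z0 _]; rewrite normrM ger0_norm ?exprn_ge0 //.
    by rewrite ler_piMr ?exprn_ge0 // (le_trans (clamp_rate_le _ _ _)).
  - exact: moment_integrable (ltnW lk) mZ Z_itv.
rewrite -RintegralZl //.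
rewrite (_ : (fun m => _) = (fun m =>
    \int[P]_w ((s m)^-1 * (Zs (s m) w ^+ l.+1 - Z w ^+ l.+1)))); last first.
  apply/funext => m; rewrite RintegralZl ?RintegralB //.
  exact: (integrableB measurableT (iZs m) iZ).
apply: (@dominated_Rintegral _ _ _ P _ _ (fun w => l.+1%:R * X w ^+ l) _ _ _ _ _).2.
- move=> m; apply: measurable_funM; first exact: measurable_cst.
  by apply: measurable_funB; apply: measurable_funX => //; exact: perturbed_measurable.
- apply: measurable_funM; first exact: measurable_cst.
  by apply: measurable_funM; [exact: measurable_funX|exact: rate_measurable].
- apply: filterS Z_itv => w zx.
  rewrite (_ : (fun m => _) = (fun m => ((s m)^-1 * (Zs (s m) w - Z w)) *
      \sum_(i < l.+1) Zs (s m) w ^+ (l - i) * Z w ^+ i)); last first.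
    by apply/funext => m; rewrite subrXX mulrA.
  rewrite mulrA mulrC; apply: cvgM; first exact: clamp_cvg.
  rewrite (_ : l.+1%:R * Z w ^+ l = \sum_(i < l.+1) Z w ^+ (l - i) * Z w ^+ i); last first.
    rewrite (eq_bigr (fun=> Z w ^+ l)) => [|i _].
      by rewrite sumr_const card_ord mulr_natl.
    by rewrite -exprD subnK // -ltnS.
  apply: cvg_big => [|i _]; first exact: add_continuous.
  apply: cvgMr_tmp.
  exact: (cvg_comp _ _ (perturbed_cvg s0 s_0 zx) (@exprn_continuous _ (l - i)%N (Z w))).
- apply: filterS Z_itv => w zx m.
  have [/andP[z0 zx'] x0] := (zx, le_trans (proj1 (andP zx)) (proj2 (andP zx))).
  have /andP[y0 yx] := @clamp_itv R (X w) (Z w + s m * t w) x0.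
  rewrite subrXX mulrA normrM -[leRHS]mul1r; apply: ler_pM => //.
    rewrite normrM gtr0_norm ?invr_gt0 // ler_pdivrMl // mulr1.
    exact: clamp_dist (ltW (s0 m)) (t_le1 w) zx.
  apply: (le_trans (ler_norm_sum _ _ _)).
  rewrite mulr_natl -[leRHS](_ : \sum_(i < l.+1) X w ^+ l = _); last first.
    by rewrite sumr_const card_ord.
  apply: ler_sum => i _; have il : (i <= l)%N by rewrite -ltnS.
  rewrite normrM !ger0_norm ?exprn_ge0 // -[in leRHS](subnK il) exprD.
  by apply: ler_pM; rewrite ?exprn_ge0 // lerXn2r // nnegrE.
- exact: (integrableZl measurableT l.+1%:R
    (moment_integrable (ltnW lk) mX X_itv)).
Qed.

Section premium_rate.
Variable Psi : 'rV[R]_k -> R.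
Hypothesis Psi_cont : {within @orthant R k, continuous Psi}.
Hypothesis Psi_C1 : continuously_differentiable_on_D Psi.
Hypothesis A1 : gradient_extends_to_Delta Psi \/
  ~ exists z, {ae P, forall w, Z w = z}.

Lemma premium_rate (s : nat -> R) :
  (forall m, 0 < s m) -> s @ \oo --> 0 ->
  (s m)^-1 * (Psi (moments (Zs (s m))) - Psi (moments Z)) @[m --> \oo] -->
    \sum_(l < k) extended_gradient Psi (moments Z) 0 l *
      (l.+1%:R * \int[P]_w (Z w ^+ l * rate w)).
Proof.
move=> s0 s_0.
have Z0 : {ae P, forall w, 0 <= Z w} by apply: filterS Z_itv => w /andP[].
have Zs0 m : {ae P, forall w, 0 <= Zs (s m) w}.
  by apply: filterS (perturbed_itv (s m)) => w /andP[].
have iZ p : (p <= k)%N -> P.-integrable setT (EFin \o (fun w => Z w ^+ p)).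
  by move=> pk; exact: moment_integrable.
have iZs m p : (p <= k)%N -> P.-integrable setT (EFin \o (fun w => Zs (s m) w ^+ p)).
  move=> pk; apply: moment_integrable => //; first exact: perturbed_measurable.
  exact: perturbed_itv.
have orth (Y : T -> R) : measurable_fun setT Y -> {ae P, forall w, 0 <= Y w} ->
    @orthant R k (moments Y).
  move=> mY Y0 l; rewrite mxE; apply: Rintegral_ge0_ae; first exact: measurable_funX.
  by apply: filterS Y0 => w; exact: exprn_ge0.
pose w : 'rV[R]_k := \row_l (l.+1%:R * \int[P]_w (Z w ^+ l * rate w)).
have rates l : (s m)^-1 * (moments (Zs (s m)) 0 l - moments Z 0 l) @[m --> \oo] --> w 0 l.
  rewrite [w 0 l]mxE (_ : (fun m => _) = (fun m => (s m)^-1 *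
    (\int[P]_v (Zs (s m) v ^+ l.+1) - \int[P]_v (Z v ^+ l.+1)))).
    exact: moment_rate.
  by apply/funext => m; rewrite !mxE.
rewrite (eq_bigr (fun l => extended_gradient Psi (moments Z) 0 l * w 0 l)); last first.
  by move=> l _; rewrite mxE.
apply: (premium_increment Psi_cont (proj1 Psi_C1)) => //.
- exact: orth.
- by move=> m; apply: orth => //; exact: perturbed_measurable.
- exact: (gradient_cvg_extended Psi_C1 mZ Z0 iZ A1).
- move=> m neq a /andP[a0 a1].
  rewrite (_ : _ + _ = \row_(l < k) ((1 - a) * \int[P]_w (Z w ^+ l.+1) +
     a * \int[P]_w (Zs (s m) w ^+ l.+1))); last first.
    by apply/rowP => l; rewrite !mxE; ring.
  apply: (mixed_moments_in_D Z0 (Zs0 m) iZ (iZs m) _ a0 a1).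
  (* two treaties equal to one constant would have the same moments *)
  move=> [tau [Ztau Zstau]]; apply: neq; apply/rowP => l; rewrite !mxE.
  apply: ae_eq_Rintegral.
  - by apply: measurable_funX; exact: perturbed_measurable.
  - exact: measurable_funX.
  - by apply: filterS2 Ztau Zstau => v -> ->.
- apply: cvg_mx => b l; rewrite (ord1 b).
  have : s m * ((s m)^-1 * (moments (Zs (s m)) 0 l - moments Z 0 l)) + moments Z 0 l
     @[m --> \oo] --> 0 * w 0 l + moments Z 0 l.
    by apply: cvgD; [exact: cvgM|exact: cvg_cst].
  rewrite mul0r add0r; apply: cvg_trans; apply: near_eq_cvg; apply: nearW => m.
  by rewrite mulVKf ?gt_eqF // subrK.
Qed.

End premium_rate.

End perturbed_moments.

(** * First-order condition along a perturbation *)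

Section shift.
Variables (R : realType) (h : R -> R).
Hypothesis ch : continuous h.

Definition shift_treaty (s : R) (p : R * R) : R := clamp p.1 (p.2 + s * h p.1).

Lemma shift_treaty_continuous s : continuous (shift_treaty s).
Proof.
apply: maxr_continuous; first by move=> p; exact: cvg_cst.
apply: minr_continuous; first exact: fst_continuous.
move=> p; apply: cvgD; first exact: snd_continuous.
apply: cvgM; first exact: cvg_cst.
by apply: continuous_comp; [exact: fst_continuous|exact: ch].
Qed.

Lemma shift_treaty_measurable s : measurable_fun setT (shift_treaty s).
Proof.
apply: measurable_maxr; first exact: measurable_cst.
apply: measurable_minr; first exact: measurable_fst.
apply: measurable_funD; first exact: measurable_snd.
apply: measurable_funM; first exact: measurable_cst.
by apply: measurableT_comp; [exact: continuous_measurable_fun|exact: measurable_fst].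
Qed.

Lemma shift_treaty_range s x z : 0 <= z <= x -> 0 <= shift_treaty s (x, z) <= x.
Proof. by move=> /andP[z0 zx]; apply: clamp_itv; exact: le_trans zx. Qed.

End shift.

Section first_order.
Variables (R : realType) (n : nat) (muX : probability (borel 'rV[R]_n) R).
Variables (k : 'I_n -> nat) (Psi : forall j, 'rV[R]_(k j) -> R).
Hypothesis Psi_ge0 : forall j (u : 'rV_(k j)), orthant u -> 0 <= Psi u.
Variables (c : R) (U : R -> R).
Hypothesis U_concave :
  convex_function (`]-oo, c]%classic : set R^o) (fun y => - U y).
Hypothesis U_nondecreasing : {in `]-oo, c] &, {homo U : x y / x <= y}}.
Hypothesis U_derivable : {in `]-oo, c[, forall y, derivable U y 1}.
Hypothesis U'_cont : {in `]-oo, c[, continuous (derive1 U)}.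
Variable nu : probability (borel (space2 R n)) R.
Hypothesis nu_optimal : optimal_randomized_strategy Psi c U muX nu.
Variable delta : R.
Hypotheses (delta_gt0 : 0 < delta)
  (A2 : (-oo < expect c nu U (fun w => (payoff Psi c nu w - delta)%R))%E).

Local Notation L := (payoff Psi c nu).
Local Notation U' := (marginal_utility c U).
Local Notation Uc y := (U (Num.min y c)).

Lemma truncated_utility_nondecreasing : {homo (fun y => Uc y) : x y / x <= y}.
Proof.
move=> x y xy; apply: U_nondecreasing.
- by rewrite in_itv /= ge_min lexx orbT.
- by rewrite in_itv /= ge_min lexx orbT.
- by rewrite le_min !ge_min xy lexx !orbT.
Qed.

Lemma truncated_utility_measurable : measurable_fun setT (fun y : R => Uc y).
Proof. exact: nondecreasing_measurable truncated_utility_nondecreasing. Qed.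

Lemma truncated_utility_le y : Uc y <= U c.
Proof. by apply: U_nondecreasing; rewrite ?in_itv /= ?ge_min ?lexx ?orbT. Qed.

Lemma U'_measurable : measurable_fun setT U'.
Proof. by apply: continuous_measurable_fun; exact: marginal_utility_continuous. Qed.

Lemma U'_truncate y : U' (Num.min y c) = U' y.
Proof.
by case: (leP y c) => // cy; rewrite [RHS]marginal_utility_end // ltW.
Qed.

Lemma closure_payoff_le mu : closure (strategies muX) mu ->
  {ae mu, forall w, payoff Psi c mu w <= c}.
Proof.
move=> clmu; have adm := closure_admissible clmu.
apply: filterS adm => w Hw; apply: payoff_le => j.
  apply: premium_ge0 => //.
  by apply: filterS (closure_admissible clmu) => v Hv; case/andP: (Hv j).
by case/andP: (Hw j).
Qed.

Lemma rhoE mu : closure (strategies muX) mu ->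
  rho Psi c U mu = (\int[mu]_w (Uc (payoff Psi c mu w))%:E)%E.
Proof.
move=> clmu; apply: expect_truncate.
- exact: payoff_measurable.
- exact: truncated_utility_measurable.
- exact: closure_payoff_le.
Qed.

Let clnu : closure (strategies muX) nu.
Proof. by case: nu_optimal. Qed.

Let Lc : {ae nu, forall w, L w <= c}.
Proof. exact: closure_payoff_le. Qed.

Let mL : measurable_fun setT L.
Proof. exact: payoff_measurable. Qed.

Lemma lowered_utility_integrable :
  nu.-integrable setT (EFin \o (fun w => Uc (L w - delta))).
Proof.
have mLd : measurable_fun setT (fun w => L w - delta).
  by apply: measurable_funB => //; exact: measurable_cst.
apply: (@bounded_above_integrable _ _ _ _ _ (U c)).
- exact: (measurableT_comp truncated_utility_measurable mLd).
- by move=> w; exact: truncated_utility_le.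
- have Ldc : {ae nu, forall w, L w - delta <= c}.
    by apply: filterS Lc => w Lw; rewrite lerBlDr (le_trans Lw) // lerDl ltW.
  by have := expect_truncate mLd truncated_utility_measurable Ldc => <-.
Qed.

(** Concavity bounds the marginal utility near [L] by a difference quotient of
    [U], which is integrable as [U (L - delta)] is. *)
Let bound w := 2 / delta * (U c - Uc (L w - delta)).

Lemma bound_integrable : nu.-integrable setT (EFin \o bound).
Proof.
have s1 : nu.-integrable setT (EFin \o cst (U c)).
  exact: finite_measure_integrable_cst.
exact: (integrableZl measurableT (2 / delta)
  (integrableB measurableT s1 lowered_utility_integrable)).
Qed.

Lemma marginal_utility_bound w y : L w <= c -> L w - delta / 2 <= y ->
  0 <= U' y <= bound w.
Proof.
move=> Lw Ly; have d0 := delta_gt0.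
apply/andP; split; first exact: marginal_utility_ge0.
apply: (@le_trans _ _ (U' (L w - delta / 2))).
  exact: marginal_utility_nonincreasing.
have a1 : L w - delta / 2 <= c by lra.
have a2 : L w - delta <= c by lra.
have := @concave_tangent _ _ _ U_concave U_nondecreasing U_derivable _ _ a1 a2.
have : U (L w - delta / 2) <= U c by apply: U_nondecreasing; rewrite ?in_itv /= ?lexx.
rewrite /bound min_l //.
move: (U' _) (U _) (U (L w - delta)) (U c) => p q r t qt H.
rewrite mulrAC ler_pdivlMr //; lra.
Qed.

Lemma marginal_utility_integrable : nu.-integrable setT (EFin \o (U' \o L)).
Proof.
apply: (@ae_le_integrable _ _ _ _ _ bound); last exact: bound_integrable.
- exact: (measurableT_comp U'_measurable mL).
- apply: filterS Lc => w Lw /=.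
  have d0 := delta_gt0.
  have /andP[u0 u1] : 0 <= U' (L w) <= bound w by apply: marginal_utility_bound => //; lra.
  by rewrite ger0_norm.
Qed.

Lemma expect_marginal_utility :
  expect c nu U' L = (\int[nu]_w (U' (L w))%:E)%E.
Proof.
have mU'c : measurable_fun setT (fun y : R => U' (Num.min y c)).
  apply: measurableT_comp; first exact: U'_measurable.
  by apply: measurable_minr => //; exact: measurable_cst.
have -> := expect_truncate mL mU'c Lc.
by apply: eq_integral => w _; rewrite U'_truncate.
Qed.

Variable i : 'I_n.
Hypothesis X_moment : nu.-integrable setT (EFin \o (fun w => xcoord i w ^+ k i)).
Hypothesis Psi_cont : {within @orthant R (k i), continuous (@Psi i)}.
Hypothesis Psi_C1 : continuously_differentiable_on_D (@Psi i).
Hypothesis A1 : gradient_extends_to_Delta (@Psi i) \/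
  ~ exists z, {ae nu, forall w, zcoord i w = z}.
Variable h : R -> R.
Hypotheses (ch : continuous h) (h_le1 : forall x, `|h x| <= 1).

Let tau s := borel_map (@replace_z_continuous R n i _ (@shift_treaty_continuous R h ch s)).
Let nu_ s : probability (borel (space2 R n)) R := distribution nu (tau s).
Let Zs s w := clamp (xcoord i w) (zcoord i w + s * h (xcoord i w)).
Let p s := premium Psi (nu_ s) i - premium Psi nu i.
Let rate w := clamp_rate (h (xcoord i w)) (xcoord i w) (zcoord i w).
Let p' : R := \sum_(l < k i)
  extended_gradient (@Psi i) (\row_(l < k i) \int[nu]_w (zcoord i w ^+ l.+1)) 0 l *
  (l.+1%:R * \int[nu]_w (zcoord i w ^+ l * rate w)).

Let clnu_ s : closure (strategies muX) (nu_ s).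
Proof.
apply: closure_pushforward => // mu; apply: strategies_replace.
  exact: shift_treaty_measurable.
exact: shift_treaty_range.
Qed.

Let zcoord_tau s j w : zcoord j (tau s w) = if j == i then Zs s w else zcoord j w.
Proof. by rewrite /zcoord /= mxE. Qed.

Let premium_other s j : j != i -> premium Psi (nu_ s) j = premium Psi nu j.
Proof.
move=> ji; rewrite /premium; congr Psi; apply/rowP => l; rewrite !mxE.
rewrite Rintegral_distribution; last exact: measurable_funX.
by apply: eq_Rintegral => w _; rewrite zcoord_tau (negPf ji).
Qed.

Let premium_same s :
  premium Psi (nu_ s) i = Psi (\row_(l < k i) \int[nu]_w (Zs s w ^+ l.+1)).
Proof.
rewrite /premium; congr Psi; apply/rowP => l; rewrite !mxE.
rewrite Rintegral_distribution; last exact: measurable_funX.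
by apply: eq_Rintegral => w _; rewrite zcoord_tau eqxx.
Qed.

Let Ls s w := L w - p s + (Zs s w - zcoord i w).

Let payoff_tau s w : payoff Psi c (nu_ s) (tau s w) = Ls s w.
Proof.
rewrite /Ls /payoff (bigD1 i) //= [in RHS](bigD1 i) //= zcoord_tau eqxx.
rewrite (eq_bigr (fun j => premium Psi nu j + xcoord j w - zcoord j w)) => [|j ji].
  rewrite /p -[xcoord i (tau s w)]/(xcoord i w); ring.
by rewrite zcoord_tau (negPf ji) premium_other.
Qed.

Let Ls_le s : {ae nu, forall w, Ls s w <= c}.
Proof.
apply: filterS (closure_admissible clnu) => w Hw; rewrite -payoff_tau.
apply: payoff_le => j.
  apply: premium_ge0 => //.
  by apply: filterS (closure_admissible (@clnu_ s)) => v Hv; case/andP: (Hv j).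
rewrite zcoord_tau -[xcoord j (tau s w)]/(xcoord j w); have /andP[z0 zx] := Hw j.
case: eqP => // ji; rewrite /Zs -ji; have x0 := le_trans z0 zx.
by have /andP[] := @clamp_itv R _ (zcoord j w + s * h (xcoord j w)) x0.
Qed.

Let mh : measurable_fun setT (h \o xcoord i).
Proof. by apply: measurableT_comp => //; exact: continuous_measurable_fun. Qed.

Let mZs s : measurable_fun setT (Zs s).
Proof. exact: perturbed_measurable. Qed.

Let mLs s : measurable_fun setT (Ls s).
Proof.
apply: measurable_funD; last exact: measurable_funB.
by apply: measurable_funB => //; exact: measurable_cst.
Qed.

Let Z_itv : {ae nu, forall w, 0 <= zcoord i w <= xcoord i w}.
Proof. by apply: filterS (closure_admissible clnu) => w Hw; exact: (Hw i). Qed.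

Let mrate : measurable_fun setT rate.
Proof. exact: rate_measurable. Qed.

Lemma premium_shift_rate (s : nat -> R) : (forall m, 0 < s m) -> s @ \oo --> 0 ->
  (s m)^-1 * p (s m) @[m --> \oo] --> p'.
Proof.
move=> s0 s_0.
have := @premium_rate _ _ _ nu (k i) (xcoord i) (zcoord i) (h \o xcoord i)
  _ _ mh Z_itv _ X_moment _ Psi_cont Psi_C1 A1 s s0 s_0.
rewrite (_ : (fun m => (s m)^-1 * p (s m)) = (fun m => (s m)^-1 *
   (Psi (\row_(l < k i) \int[nu]_w (Zs (s m) w ^+ l.+1)) -
    Psi (\row_(l < k i) \int[nu]_w (zcoord i w ^+ l.+1))))); last first.
  by apply/funext => m; rewrite /p premium_same.
by apply => // w; exact: h_le1.
Qed.

Lemma utility_integrable Y : measurable_fun setT Y ->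
  {ae nu, forall w, L w - delta <= Y w} ->
  nu.-integrable setT (EFin \o (fun w => Uc (Y w))).
Proof.
move=> mY LY.
apply: (@ae_le_integrable _ _ _ _ _ (fun w => `|Uc (L w - delta)| + `|U c|)).
- exact: (measurableT_comp truncated_utility_measurable mY).
- apply: filterS LY => w /truncated_utility_nondecreasing Uw.
  have := truncated_utility_le (Y w); move: Uw.
  rewrite ler_norml; have := ler_norm (U c); have := ler_norm (- Uc (L w - delta)).
  rewrite normrN; have := normr_ge0 (U c); have := normr_ge0 (Uc (L w - delta)).
  by move=> *; apply/andP; split; lra.
- have s1 : nu.-integrable setT (EFin \o cst (`|U c|)).
    exact: finite_measure_integrable_cst.
  exact: (integrableD measurableT (integrable_norm lowered_utility_integrable) s1).
Qed.

Let Ls_dist s w : 0 < s -> 0 <= zcoord i w <= xcoord i w ->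
  `|Ls s w - L w| <= s + `|p s|.
Proof.
move=> s0 zx.
have -> : Ls s w - L w = (Zs s w - zcoord i w) - p s by rewrite /Ls; ring.
rewrite (le_trans (ler_normB _ _)) // lerD2r.
exact: clamp_dist (ltW s0) (h_le1 _) zx.
Qed.

(** By concavity, the integrand is at most the gain [U (Ls) - U (L)], whose mean
    is nonpositive by optimality.  The smallness conditions keep [Ls] above
    [L - delta / 2], where [U'] is controlled by [bound]. *)
Lemma optimality_step s : 0 < s -> s <= delta / 4 -> `|p s| <= delta / 4 ->
  nu.-integrable setT (EFin \o (fun w => U' (Ls s w) * (Ls s w - L w))) /\
  \int[nu]_w (U' (Ls s w) * (Ls s w - L w)) <= 0.
Proof.
move=> s0 s4 p4; have d0 := delta_gt0.
have near_L : {ae nu, forall w, `|Ls s w - L w| <= delta / 2}.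
  by apply: filterS Z_itv => w zx; apply: le_trans (Ls_dist s0 zx) _; lra.
have iL : nu.-integrable setT (EFin \o (fun w => Uc (L w))).
  by apply: utility_integrable => //; apply: nearW => w; lra.
have iLs : nu.-integrable setT (EFin \o (fun w => Uc (Ls s w))).
  apply: utility_integrable; first exact: mLs.
  by apply: filterS near_L => w; rewrite ler_norml; lra.
have opt : \int[nu]_w Uc (Ls s w) <= \int[nu]_w Uc (L w).
  have := (proj2 nu_optimal) (nu_ s) (@clnu_ s).
  rewrite !rhoE // integral_distribution_measurable; last first.
    apply/measurable_EFinP; apply: (measurableT_comp truncated_utility_measurable).
    exact: payoff_measurable.
  under eq_integral do rewrite payoff_tau.
  by move=> H; apply: fine_le => //; [exact: integrable_fin_num iLs|exact: integrable_fin_num iL].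
have iD : nu.-integrable setT (EFin \o (fun w => U' (Ls s w) * (Ls s w - L w))).
  apply: (@ae_le_integrable _ _ _ _ _ (fun w => delta / 2 * bound w)).
  - apply: measurable_funM; first exact: (measurableT_comp U'_measurable (mLs s)).
    by apply: measurable_funB => //; exact: mLs.
  - apply: filterS2 Lc near_L => w Lw Hw.
    have /andP[u0 u1] : 0 <= U' (Ls s w) <= bound w.
      by apply: marginal_utility_bound => //; move: Hw; rewrite ler_norml; lra.
    rewrite normrM mulrC (ger0_norm u0).
    by apply: ler_pM.
  - exact: (integrableZl measurableT (delta / 2) bound_integrable).
split=> //; apply: (@le_trans _ _ (\int[nu]_w (Uc (Ls s w) - Uc (L w)))); last first.
  by rewrite RintegralB // subr_le0.
apply: ae_le_Rintegral => //; first exact: (integrableB measurableT iLs iL).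
apply: filterS2 Lc (Ls_le s) => w Lw Lsw.
have := @concave_tangent _ _ _ U_concave U_nondecreasing U_derivable _ _ Lsw Lw.
by rewrite !min_l //; lra.
Qed.

Lemma first_order_condition : \int[nu]_w (U' (L w) * (rate w - p')) <= 0.
Proof.
have d0 := delta_gt0.
pose r (m : nat) : R := m.+1%:R^-1.
have r0 m : 0 < r m by rewrite invr_gt0.
have r_0 : r @ \oo --> 0 by exact: cvg_harmonic.
pose M := `|p'| + 1.
have M0 : 0 < M by rewrite ltr_wpDl.
have rate_r := premium_shift_rate r0 r_0.
have ev : \forall m \near \oo,
    [/\ r m <= delta / 4, M * r m <= delta / 4 & `|(r m)^-1 * p (r m)| <= M].
  have d4 : 0 < delta / 4 by lra.
  have ev1 : \forall m \near \oo, r m <= delta / 4 by exact: (cvgr_le _ r_0).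
  have Mr : M * r m @[m --> \oo] --> 0.
    by rewrite -(mulr0 M); apply: cvgMl_tmp.
  have ev2 : \forall m \near \oo, M * r m <= delta / 4 by exact: (cvgr_le _ Mr).
  have nrate : `|(r m)^-1 * p (r m)| @[m --> \oo] --> `|p'| by exact: cvg_norm.
  have ev3 : \forall m \near \oo, `|(r m)^-1 * p (r m)| <= M.
    by apply: (cvgr_le _ nrate); rewrite ltrDl.
  by apply: filterS3 ev1 ev2 ev3.
have [N _ HN] := ev.
(* the sequence starts at rank N, from which each step is small enough for
   optimality_step *)
pose s (m : nat) : R := r (m + N)%N.
have Hs m : [/\ s m <= delta / 4, M * s m <= delta / 4 & `|(s m)^-1 * p (s m)| <= M].
  by apply: HN; rewrite /= leq_addl.
have s0 m : 0 < s m by exact: r0.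
have s_0 : s @ \oo --> 0 by exact: (cvg_comp _ _ (cvg_addnr N) r_0).
have p_le m : `|p (s m)| <= M * s m.
  have [_ _] := Hs m; rewrite normrM gtr0_norm ?invr_gt0 // ler_pdivrMl // mulrC.
  by rewrite mulrC.
have p4 m : `|p (s m)| <= delta / 4 by apply: le_trans (p_le m) _; have [] := Hs m.
have prate := premium_shift_rate s0 s_0.
have p_0 : p (s m) @[m --> \oo] --> 0.
  rewrite -(mul0r p') (_ : (fun m => p (s m)) = (fun m => s m * ((s m)^-1 * p (s m)))).
    exact: cvgM.
  by apply/funext => m; rewrite mulVKf // gt_eqF.
have step m : \int[nu]_w ((s m)^-1 * (U' (Ls (s m) w) * (Ls (s m) w - L w))) <= 0.
  have [s4 _ _] := Hs m; have [iD D0] := optimality_step (s0 m) s4 (p4 m).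
  by rewrite RintegralZl // pmulr_rle0 ?invr_gt0.
have [_ lim] : nu.-integrable setT (EFin \o (fun w => U' (L w) * (rate w - p'))) /\
    \int[nu]_w ((s m)^-1 * (U' (Ls (s m) w) * (Ls (s m) w - L w))) @[m --> \oo] -->
    \int[nu]_w (U' (L w) * (rate w - p')).
  apply: (@dominated_Rintegral _ _ _ nu _ _ (fun w => (1 + M) * bound w)).
  - move=> m; apply: measurable_funM; first exact: measurable_cst.
    apply: measurable_funM; first exact: (measurableT_comp U'_measurable (mLs (s m))).
    by apply: measurable_funB => //; exact: mLs.
  - apply: measurable_funM; first exact: (measurableT_comp U'_measurable mL).
    by apply: measurable_funB => //; exact: measurable_cst.
  - apply: filterS Z_itv => w zx.
    have rate_w := @clamp_cvg _ _ (h (xcoord i w)) _ _ s0 s_0 zx.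
    have Ls_L : Ls (s m) w @[m --> \oo] --> L w.
      have : L w - p (s m) + (Zs (s m) w - zcoord i w) @[m --> \oo] -->
          L w - 0 + (zcoord i w - zcoord i w); last by rewrite subr0 subrr addr0.
      apply: cvgD; first by apply: cvgB; [exact: cvg_cst|exact: p_0].
      apply: cvgB; last exact: cvg_cst.
      apply: (@perturbed_cvg _ _ _ (xcoord i) (zcoord i) (h \o xcoord i)) => // v.
      exact: h_le1.
    have H : U' (Ls (s m) w) *
        ((s m)^-1 * (Zs (s m) w - zcoord i w) - (s m)^-1 * p (s m)) @[m --> \oo] -->
        U' (L w) * (rate w - p').
      apply: cvgM; last exact: cvgB.
      apply: (cvg_comp _ _ Ls_L); exact: marginal_utility_continuous.
    apply: cvg_trans H; apply: near_eq_cvg; apply: nearW => m; rewrite /Ls; ring.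
  - apply: filterS2 Lc Z_itv => w Lw zx m.
    have [s4 _ _] := Hs m; have dist := Ls_dist (s0 m) zx.
    have /andP[u0 u1] : 0 <= U' (Ls (s m) w) <= bound w.
      by apply: marginal_utility_bound => //; move: dist (p4 m); rewrite ler_norml; lra.
    rewrite mulrCA normrM mulrC (ger0_norm u0); apply: ler_pM => //.
    rewrite normrM gtr0_norm ?invr_gt0 // ler_pdivrMl // (le_trans dist) //.
    by have := p_le m; lra.
  - exact: (integrableZl measurableT (1 + M) bound_integrable).
rewrite -(cvg_lim (@Rhausdorff R) lim); apply: limr_le.
  by apply/cvg_ex; eexists; exact: lim.
by apply: nearW => m; exact: step.
Qed.

End first_order.

(** * Pointwise conditions *)

Lemma Rintegral_lincomb d (T : measurableType d) (R : realType)
    (mu : {measure set T -> \bar R}) (I : Type) (r : seq I) (a : I -> R) (f : I -> T -> R) :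
  (forall j, mu.-integrable setT (EFin \o f j)) ->
  mu.-integrable setT (EFin \o (fun x => \sum_(j <- r) a j * f j x)) /\
  \int[mu]_x (\sum_(j <- r) a j * f j x) = \sum_(j <- r) a j * \int[mu]_x f j x.
Proof.
move=> sf; elim: r => [|j r [IHi IHr]].
  rewrite (_ : (fun x => _) = fun=> 0); last by apply/funext => x; rewrite big_nil.
  by split; [exact: integrable0|rewrite big_nil /Rintegral integral0].
have sj : mu.-integrable setT (EFin \o (fun x => a j * f j x)).
  exact: (integrableZl measurableT (a j) (sf j)).
rewrite (_ : (fun x => _) = (fun x => a j * f j x + \sum_(i <- r) a i * f i x)); last first.
  by apply/funext => x; rewrite big_cons.
split; first exact: (integrableD measurableT sj IHi).
by rewrite RintegralD // RintegralZl // IHr big_cons.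
Qed.

Section stationarity.
Variables (R : realType) (n : nat) (muX : probability (borel 'rV[R]_n) R).
Variables (k : 'I_n -> nat) (Psi : forall j, 'rV[R]_(k j) -> R).
Hypothesis Psi_ge0 : forall j (u : 'rV_(k j)), orthant u -> 0 <= Psi u.
Variables (c : R) (U : R -> R).
Hypothesis U_concave :
  convex_function (`]-oo, c]%classic : set R^o) (fun y => - U y).
Hypothesis U_nondecreasing : {in `]-oo, c] &, {homo U : x y / x <= y}}.
Hypothesis U_derivable : {in `]-oo, c[, forall y, derivable U y 1}.
Hypothesis U'_cont : {in `]-oo, c[, continuous (derive1 U)}.
Variable nu : probability (borel (space2 R n)) R.
Hypothesis nu_optimal : optimal_randomized_strategy Psi c U muX nu.
Variable delta : R.
Hypotheses (delta_gt0 : 0 < delta)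
  (A2 : (-oo < expect c nu U (fun w => (payoff Psi c nu w - delta)%R))%E).
Variable i : 'I_n.
Hypothesis X_moment : nu.-integrable setT (EFin \o (fun w => xcoord i w ^+ k i)).
Hypothesis Psi_cont : {within @orthant R (k i), continuous (@Psi i)}.
Hypothesis Psi_C1 : continuously_differentiable_on_D (@Psi i).
Hypothesis A1 : gradient_extends_to_Delta (@Psi i) \/
  ~ exists z, {ae nu, forall w, zcoord i w = z}.
Variables (Zi : R -> R) (Zi_measurable : measurable_fun setT Zi).
Hypothesis Zi_deterministic : {ae nu, forall w, zcoord i w = Zi (xcoord i w)}.
Variables (Q : R.-pker R ~> borel (space2' R n))
          (Q_law : is_regular_cond_law nu (xcoord i) (@others R n i) Q).

Local Notation L := (payoff Psi c nu).
Local Notation U' := (marginal_utility c U).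
Local Notation law := (distribution nu (xcoord i)).
Local Notation cond_expect x :=
  (expect c (Q x) U' (fun v => L (insert2 i x (Zi x) v))).
Local Notation u := (\row_(l < k i) \int[nu]_w (zcoord i w ^+ l.+1)).
Local Notation marginal_premium x :=
  (\sum_(l < k i) extended_gradient (@Psi i) u 0 l * l.+1%:R * Zi x ^+ l).

Let clnu : closure (strategies muX) nu.
Proof. by case: nu_optimal. Qed.

Let Lc : {ae nu, forall w, L w <= c}.
Proof. exact: (closure_payoff_le Psi_ge0 c clnu). Qed.

Let mL : measurable_fun setT L.
Proof. exact: payoff_measurable. Qed.

Let mU' : measurable_fun setT U'.
Proof. exact: (U'_measurable U_concave U_nondecreasing U_derivable U'_cont). Qed.

Let iU' : nu.-integrable setT (EFin \o (U' \o L)).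
Proof.
exact: (marginal_utility_integrable Psi_ge0 U_concave U_nondecreasing U_derivable
  U'_cont nu_optimal delta_gt0 A2).
Qed.

Let U'_ge0 y : 0 <= U' y.
Proof. exact: marginal_utility_ge0. Qed.

Lemma insert_others (w : borel (space2 R n)) :
  insert2 i (xcoord i w) (zcoord i w) (others i w) = w.
Proof.
case: w => x z; rewrite /insert2 /others /insert /=; congr (_, _);
  by apply/rowP => j; rewrite !mxE; case: unliftP => [l ->|->]; rewrite ?mxE.
Qed.

Let Lins (p : R * borel (space2' R n)) : R := L (insert2 i p.1 (Zi p.1) p.2).

Lemma payoff_insert_measurable : measurable_fun setT Lins.
Proof.
rewrite /Lins /payoff; apply: measurable_funB; first exact: measurable_cst.
apply: measurable_sum => j; apply: measurable_funB.
  apply: measurable_funD; first exact: measurable_cst.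
  rewrite (_ : (fun p => _) = (fun p : R * borel (space2' R n) =>
    if unlift i j is Some l then xcoord (l : 'I_n.-1) p.2 else p.1)).
    case: unlift => [l|]; last exact: measurable_fst.
    exact: (measurableT_comp (@measurable_xcoord R n.-1 l) measurable_snd).
  by apply/funext => p; rewrite /xcoord /= mxE.
rewrite (_ : (fun p => _) = (fun p : R * borel (space2' R n) =>
  if unlift i j is Some l then zcoord (l : 'I_n.-1) p.2 else Zi p.1)).
  case: unlift => [l|]; last exact: (measurableT_comp Zi_measurable measurable_fst).
  exact: (measurableT_comp (@measurable_zcoord R n.-1 l) measurable_snd).
by apply/funext => p; rewrite /zcoord /= mxE.
Qed.

Let G (p : R * borel (space2' R n)) : \bar R :=
  if Lins p <= c then (U' (Lins p))%:E else 0%E.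

Let mG : measurable_fun setT G.
Proof.
apply: measurable_fun_ifT.
- by apply: measurable_fun_ler; [exact: payoff_insert_measurable|exact: measurable_cst].
- by apply/measurable_EFinP; exact: (measurableT_comp mU' payoff_insert_measurable).
- exact: measurable_cst.
Qed.

Let G_ge0 p : (0 <= G p)%E.
Proof. by rewrite /G; case: ifP => //; rewrite lee_fin U'_ge0. Qed.

Let cond_expectE x : cond_expect x = (\int[Q x]_v G (x, v))%E.
Proof.
rewrite /expect integral_mkcond; apply: eq_integral => v _; rewrite patchE /G /Lins /=.
case: ifPn => [|/negP]; rewrite inE /= => Lx; first by rewrite Lx.
by case: ifPn.
Qed.

Lemma cond_expect_ge0 x : (0 <= cond_expect x)%E.
Proof. by rewrite cond_expectE; apply: integral_ge0. Qed.

Lemma cond_expect_measurable : measurable_fun setT (fun x => cond_expect x).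
Proof.
under eq_fun do rewrite cond_expectE.
exact: measurable_fun_integral_finite_kernel.
Qed.

(** As [Z_i] is a function of [X_i], the payoff is almost surely a function of
    [X_i] and of the other coordinates, and [Q] is the conditional law of the
    latter. *)
Lemma cond_expect_disintegration (psi : R -> R) : measurable_fun setT psi ->
  (forall x, 0 <= psi x) ->
  (\int[law]_x ((psi x)%:E * cond_expect x) =
   \int[nu]_w (psi (xcoord i w) * U' (L w))%:E)%E.
Proof.
move=> mpsi psi0.
have mpsi1 : measurable_fun setT (fun p : R * borel (space2' R n) => (psi p.1)%:E).
  by apply/measurable_EFinP; apply: measurableT_comp.
have mpsiG : measurable_fun setT
    (fun p : R * borel (space2' R n) => ((psi p.1)%:E * G p)%E).
  exact: emeasurable_funM.
have G0 p : (0 <= (psi p.1)%:E * G p)%E by rewrite mule_ge0 ?lee_fin.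
transitivity (\int[nu]_w ((psi (xcoord i w))%:E * G (xcoord i w, others i w)))%E.
  rewrite (regular_cond_law_integral (measurable_others i) Q_law mpsiG G0).
  apply: eq_integral => x _ /=; rewrite cond_expectE ge0_integralZl //.
    exact: (measurableT_comp mG (measurable_pair1 _)).
  by rewrite lee_fin.
apply: ae_eq_integral => //.
- have mJ : measurable_fun setT
      (fun w : borel (space2 R n) => (xcoord i w, others i w) : R * borel (space2' R n)).
    exact: (measurable_fun_pair (measurable_xcoord i) (@measurable_others R n i)).
  exact: (measurableT_comp mpsiG mJ).
- apply/measurable_EFinP; apply: measurable_funM; first exact: measurableT_comp.
  exact: (measurableT_comp mU' mL).
- apply: filterS2 Lc Zi_deterministic => w Lw Zw _.
  by rewrite /G /Lins /= -Zw insert_others Lw -EFinM.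
Qed.

Let cond_expect_total : (\int[law]_x cond_expect x = \int[nu]_w (U' (L w))%:E)%E.
Proof.
have := @cond_expect_disintegration (fun=> 1) (measurable_cst _) (fun=> ler01).
under eq_integral do rewrite mul1e.
by under [RHS]eq_integral do rewrite mul1r.
Qed.

Lemma cond_expect_integrable : law.-integrable setT (fun x => cond_expect x).
Proof.
apply/integrableP; split; first exact: cond_expect_measurable.
under eq_integral do rewrite (gee0_abs (cond_expect_ge0 _)).
rewrite cond_expect_total; apply: (@integrable_lty _ _ _ nu setT measurableT _ iU').
Qed.

Let cr x : R := fine (cond_expect x).

Let cr_fin : {ae law, forall x, (cr x)%:E = cond_expect x}.
Proof.
by apply: filterS (integrable_ae measurableT cond_expect_integrable) => x /(_ I) /fineK.
Qed.

Let mcr : measurable_fun setT cr.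
Proof. by apply: measurableT_comp; [exact: fine_measurable|exact: cond_expect_measurable]. Qed.

Let cr_integrable : law.-integrable setT (EFin \o cr).
Proof.
apply: (le_integrable measurableT _ _ cond_expect_integrable).
  exact/measurable_EFinP.
move=> x _ /=; rewrite /cr; case: (cond_expect x) => [y| |] //=.
- by rewrite normr0 leey.
- by rewrite normr0 leey.
Qed.

Let Z_itv : {ae nu, forall w, 0 <= zcoord i w <= xcoord i w}.
Proof. by apply: filterS (closure_admissible clnu) => w Hw; exact: (Hw i). Qed.

Let mZiX : measurable_fun setT (fun w : borel (space2 R n) => Zi (xcoord i w)).
Proof. exact: (measurableT_comp Zi_measurable (measurable_xcoord i)). Qed.

Let power_integrable l : (l < k i)%N ->
  law.-integrable setT (EFin \o (fun x => Zi x ^+ l)).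
Proof.
move=> lk; apply: integrable_pushforward => //.
  by apply/measurable_EFinP; exact: measurable_funX.
apply: (@ae_le_integrable _ _ _ _ _ (fun w => zcoord i w ^+ l)).
- exact: measurable_funX.
- apply: filterS2 Z_itv Zi_deterministic => w /andP[z0 _] <-.
  by rewrite ger0_norm // exprn_ge0.
- exact: (moment_integrable X_moment (ltnW lk) (measurable_zcoord i) Z_itv).
Qed.

Let E1 : R := \int[nu]_w U' (L w).
Let kappa x : R := cr x - marginal_premium x * E1.

(** [first_order_condition] rewritten on the line: as the rate of the move is a
    function [eps * psi] of [X_i], each of its terms is an integral against
    the law of [X_i].  The sign [eps] allows [psi] to be nonnegative, as
    [cond_expect_disintegration] requires. *)
Lemma weighted_stationarity (h psi : R -> R) (eps : R) :
  continuous h -> (forall x, `|h x| <= 1) ->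
  measurable_fun setT psi -> (forall x, 0 <= psi x <= 1) ->
  (forall x, 0 <= Zi x <= x -> clamp_rate (h x) x (Zi x) = eps * psi x) ->
  law.-integrable setT (EFin \o (fun x => psi x * kappa x)) /\
  eps * \int[law]_x (psi x * kappa x) <= 0.
Proof.
move=> ch h1 mpsi psi01 rateE.
have psi0 x : 0 <= psi x by case/andP: (psi01 x).
have psi1 x : `|psi x| <= 1 by rewrite ger0_norm //; case/andP: (psi01 x).
have weight d (T : measurableType d) (mu : probability T R) (g f : T -> R) :
    measurable_fun setT g -> (forall x, `|g x| <= 1) ->
    mu.-integrable setT (EFin \o f) ->
    mu.-integrable setT (EFin \o (fun x => g x * f x)).
  move=> mg g1 sf; apply: (@ae_le_integrable _ _ _ _ _ (fun x => `|f x|)).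
  - by apply: measurable_funM => //; apply/measurable_EFinP; exact: measurable_int sf.
  - by apply: nearW => x; rewrite normrM ler_piMl.
  - exact: integrable_norm.
pose rate w := clamp_rate (h (xcoord i w)) (xcoord i w) (zcoord i w).
have rate_psi : {ae nu, forall w, rate w = eps * psi (xcoord i w)}.
  by apply: filterS2 Z_itv Zi_deterministic => w zx Zw; rewrite /rate Zw rateE // -Zw.
have mh : measurable_fun setT (fun w : borel (space2 R n) => h (xcoord i w)).
  exact: (measurableT_comp (continuous_measurable_fun ch) (measurable_xcoord i)).
have mrate : measurable_fun setT rate.
  exact: (rate_measurable (measurable_xcoord i) (measurable_zcoord i) mh).
have rate1 w : `|rate w| <= 1 by rewrite (le_trans (clamp_rate_le _ _ _)).
have mpsiX : measurable_fun setT (fun w : borel (space2 R n) => psi (xcoord i w)).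
  exact: (measurableT_comp mpsi (measurable_xcoord i)).
pose a (l : 'I_(k i)) := extended_gradient (@Psi i) u 0 l * l.+1%:R.
have pw (l : 'I_(k i)) : law.-integrable setT (EFin \o (fun x => psi x * Zi x ^+ l)).
  exact: (weight _ _ law _ _ mpsi psi1 (power_integrable (ltn_ord l))).
have [iM EM] := Rintegral_lincomb (index_enum 'I_(k i)) a pw.
have moment_rateE (l : 'I_(k i)) :
    \int[nu]_w (zcoord i w ^+ l * rate w) = eps * \int[law]_x (psi x * Zi x ^+ l).
  rewrite -RintegralZl // Rintegral_distribution; last first.
    apply: measurable_funM; first exact: measurable_cst.
    by apply: measurable_funM => //; exact: measurable_funX.
  apply: ae_eq_Rintegral.
  - by apply: measurable_funM => //; exact: measurable_funX.
  - apply: measurable_funM; first exact: measurable_cst.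
    by apply: measurable_funM => //; exact: measurable_funX.
  - by apply: filterS2 rate_psi Zi_deterministic => w -> ->; rewrite mulrC mulrA.
have iUrate := weight _ _ nu _ _ mrate rate1 iU'.
have iUpsi : nu.-integrable setT (EFin \o (fun w => psi (xcoord i w) * U' (L w))).
  exact: (weight _ _ nu _ _ mpsiX (fun w => psi1 (xcoord i w)) iU').
have EU : \int[law]_x (psi x * cr x) = \int[nu]_w (psi (xcoord i w) * U' (L w)).
  rewrite /Rintegral -cond_expect_disintegration //; congr fine.
  apply: ae_eq_integral => //.
  - by apply/measurable_EFinP; exact: measurable_funM.
  - apply: emeasurable_funM; first exact/measurable_EFinP.
    exact: cond_expect_measurable.
  - by apply: filterS cr_fin => x <- _; rewrite EFinM.
have EUrate : \int[nu]_w (rate w * U' (L w)) = eps * \int[law]_x (psi x * cr x).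
  rewrite EU -RintegralZl //; apply: ae_eq_Rintegral.
  - by apply: measurable_funM => //; exact: (measurableT_comp mU' mL).
  - apply: measurable_funM; first exact: measurable_cst.
    by apply: measurable_funM => //; exact: (measurableT_comp mU' mL).
  - by apply: filterS rate_psi => w ->; rewrite mulrA.
have icr := weight _ _ law _ _ mpsi psi1 cr_integrable.
have iME : law.-integrable setT
    (EFin \o (fun x => E1 * \sum_(l < k i) a l * (psi x * Zi x ^+ l))).
  exact: (integrableZl measurableT E1 iM).
have kappaE : (fun x => psi x * kappa x) = (fun x => psi x * cr x -
    E1 * \sum_(l < k i) a l * (psi x * Zi x ^+ l)).
  apply/funext => x; rewrite /kappa mulrBr; congr (_ - _).
  rewrite mulrA mulrC mulr_sumr; congr (_ * _); apply: eq_bigr => l _.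
  by rewrite /a mulrCA.
split; first by rewrite kappaE; exact: (integrableB measurableT icr iME).
have := first_order_condition Psi_ge0 U_concave U_nondecreasing U_derivable
  U'_cont nu_optimal delta_gt0 A2 X_moment Psi_cont Psi_C1 A1 ch h1.
set p' := \sum_(l < k i) _.
have -> : p' = eps * \int[law]_x (\sum_(l < k i) a l * (psi x * Zi x ^+ l)).
  rewrite EM mulr_sumr; apply: eq_bigr => l _.
  by rewrite moment_rateE /a; ring.
have -> : (fun w => U' (L w) * (rate w - eps * \int[law]_x (\sum_(l < k i) a l * (psi x * Zi x ^+ l))))
  = (fun w => rate w * U' (L w) - eps * \int[law]_x (\sum_(l < k i) a l * (psi x * Zi x ^+ l)) * U' (L w)).
  by apply/funext => w; ring.
rewrite RintegralB //; last exact: (integrableZl measurableT _ iU').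
rewrite RintegralZl // EUrate => H.
rewrite kappaE RintegralB // RintegralZl //.
by rewrite mulrBr [E1 * _]mulrC mulrA.
Qed.

Let expect_E1 : expect c nu U' L = E1%:E.
Proof.
rewrite (expect_marginal_utility Psi_ge0 U_concave U_nondecreasing U_derivable
  U'_cont nu_optimal) /E1 /Rintegral fineK //.
exact: integrable_fin_num iU'.
Qed.

Let select_measurable (b : R -> bool) (h : R -> R) : measurable_fun setT b ->
  measurable_fun setT h -> measurable_fun setT (fun x => if b x then h x else 0).
Proof. by move=> mb mh; apply: measurable_fun_ifT => //; exact: measurable_cst. Qed.

(** Moves upwards: [h >= 0] acts where the treaty is below [x]. *)
Lemma stationarity_upper : {ae law, forall x, Zi x < x ->
  (cond_expect x <= (marginal_premium x)%:E * expect c nu U' L)%E}.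
Proof.
have key (h : R -> R) : continuous h -> (forall x, 0 <= h x <= 1) ->
    law.-integrable setT (EFin \o (fun x => (if Zi x < x then h x else 0) * kappa x)) /\
    1 * \int[law]_x ((if Zi x < x then h x else 0) * kappa x) <= 0.
  move=> ch h01; apply: (weighted_stationarity ch).
  - by move=> x; have /andP[h0 h1] := h01 x; rewrite ger0_norm.
  - apply: select_measurable; first by apply: measurable_fun_ltr.
    exact: continuous_measurable_fun.
  - by move=> x; case: ifP => // _; rewrite lexx ler01.
  - by move=> x _; rewrite /clamp_rate mul1r; have /andP[-> _] := h01 x.
have [i1 _] := key (fun=> 1) (fun x => cvg_cst _) (fun x => introT andP (conj ler01 (lexx _))).
have := @ae_le0_continuous_tests R law _ i1.
have tests (h : R -> R) : continuous h -> (forall x, 0 <= h x <= 1) ->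
    \int[law]_x (h x * ((if Zi x < x then 1 else 0) * kappa x)) <= 0.
  move=> ch h01; have [_] := key h ch h01; rewrite mul1r.
  congr (_ <= _); congr Rintegral; apply/funext => x; rewrite mulrA; congr (_ * _).
  by case: ifP; rewrite ?mulr1 ?mulr0.
move=> /(_ tests); apply: filterS2 cr_fin => x <- + Zx; rewrite Zx mul1r.
by rewrite expect_E1 -EFinM lee_fin /kappa subr_le0.
Qed.

(** Moves downwards: [- h <= 0] acts where the treaty is positive. *)
Lemma stationarity_lower : {ae law, forall x, 0 < Zi x ->
  ((marginal_premium x)%:E * expect c nu U' L <= cond_expect x)%E}.
Proof.
have key (h : R -> R) : continuous h -> (forall x, 0 <= h x <= 1) ->
    law.-integrable setT (EFin \o (fun x => (if 0 < Zi x then h x else 0) * kappa x)) /\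
    -1 * \int[law]_x ((if 0 < Zi x then h x else 0) * kappa x) <= 0.
  move=> ch h01; apply: (@weighted_stationarity (fun x => - h x)).
  - by move=> x; apply: cvgN; exact: ch.
  - by move=> x; have /andP[h0 h1] := h01 x; rewrite normrN ger0_norm.
  - apply: select_measurable; last exact: continuous_measurable_fun.
    by apply: measurable_fun_ltr => //; exact: measurable_cst.
  - by move=> x; case: ifP => // _; rewrite lexx ler01.
  - move=> x _; rewrite /clamp_rate mulN1r oppr_ge0.
    have /andP[h0 _] := h01 x; have [h0'|h0'] := leP (h x) 0.
      have -> : h x = 0 by apply: le_anti; rewrite h0 h0'.
      by rewrite oppr0 !if_same oppr0.
    by case: ifP; rewrite ?oppr0.
have [i1 _] := key (fun=> 1) (fun x => cvg_cst _) (fun x => introT andP (conj ler01 (lexx _))).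
have iN := integrableZl measurableT (-1) i1.
have := @ae_le0_continuous_tests R law _ iN.
have tests (h : R -> R) : continuous h -> (forall x, 0 <= h x <= 1) ->
    \int[law]_x (h x * (-1 * ((if 0 < Zi x then 1 else 0) * kappa x))) <= 0.
  move=> ch h01; have [ih] := key h ch h01; rewrite -RintegralZl //.
  congr (_ <= _); congr Rintegral; apply/funext => x.
  by case: ifP => _; ring.
move=> /(_ tests); apply: filterS2 cr_fin => x <- + Zx; rewrite Zx mul1r mulN1r.
by rewrite expect_E1 -EFinM lee_fin /kappa oppr_le0 subr_ge0.
Qed.

End stationarity.

(** * Optimality conditions *)

Lemma ae_probability_eq1 d (T : measurableType d) (R : realType)
    (P : probability T R) (A : set T) : measurable A ->
  {ae P, forall w, A w} -> P A = 1%E.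
Proof.
move=> mA [N [mN N0 AN]].
have AC0 : P (~` A) = 0%E.
  by apply: (subset_measure0 _ mN AN N0); exact: measurableC.
by have := probability_setC P (measurableC mA); rewrite setCK AC0 sube0.
Qed.

Lemma ae_eq_measure d (T : measurableType d) (R : realType)
    (m1 m2 : {measure set T -> \bar R}) (Q : T -> Prop) :
  (forall A, measurable A -> m1 A = m2 A) ->
  {ae m1, forall x, Q x} -> {ae m2, forall x, Q x}.
Proof. by move=> m12 [N [mN N0 QN]]; exists N; rewrite -m12. Qed.

Theorem theorem4p8 (R : realType) (n : nat) (n_ge2 : (2 <= n)%N)
  (d : measure_display) (Omega : measurableType d) (P : probability Omega R)
  (X : {RV P >-> borel 'rV[R]_n})
  (X_ge0 : forall omega j, 0 <= component j (X omega))
  (k : 'I_n -> nat) (k_ge1 : forall j, (1 <= k j)%N)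
  (X_moment : forall j,
    (\int[P]_omega (component j (X omega) ^+ k j)%:E < +oo)%E)
  (Psi : forall j, 'rV[R]_(k j) -> R)
  (Psi_ge0 : forall j u, orthant u -> 0 <= Psi j u)
  (Psi_cont : forall j, {within @orthant R (k j), continuous (Psi j)})
  (c : R) (U : R -> R)
  (U_concave : convex_function (`]-oo, c]%classic : set R^o) (fun y => - U y))
  (U_nondecreasing : {in `]-oo, c] &, {homo U : x y / x <= y}})
  (U_derivable : {in `]-oo, c[, forall y, derivable U y 1})
  (U'_cont : {in `]-oo, c[, continuous (derive1 U)})
  (nu : probability (borel (space2 R n)) R)
  (nu_optimal : optimal_randomized_strategy Psi c U (distribution P X) nu)
  (i : 'I_n)
  (Psi_i_cont :
    {within Dset (k := k i) `|` Deltaset (k := k i), continuous (Psi i)})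
  (Psi_i_C1 : continuously_differentiable_on_D (Psi i))
  (A1 : gradient_extends_to_Delta (Psi i) \/
        ~ exists z : R, distribution nu (zcoord i) [set z] = 1%E)
  (A2 : exists2 delta : R, 0 < delta &
        (-oo < expect c nu U (fun w => (payoff Psi c nu w - delta)%R))%E)
  (muXi_ac : forall A : set R, measurable A -> lebesgue_measure A = 0%E ->
    distribution (distribution P X) (component i) (A `\ (0 : R)) = 0%E)
  (Zi : R -> R) (Zi_measurable : measurable_fun setT Zi)
  (Zi_deterministic : {ae nu, forall w, zcoord i w = Zi (xcoord i w)})
  (Q : R.-pker R ~> borel (space2' R n))
  (Q_law : is_regular_cond_law nu (xcoord i) (@others R n i) Q) :
  let muXi := distribution (distribution P X) (component i) in
  let U' := marginal_utility c U in
  let cond_expect (x : R) : \bar R :=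
    expect c (Q x) U' (fun v => payoff Psi c nu (insert2 i x (Zi x) v)) in
  let u : 'rV[R]_(k i) := \row_l \int[muXi]_x (Zi x ^+ l.+1) in
  let marginal_premium (x : R) : R :=
    \sum_(l < k i) extended_gradient (Psi i) u 0 l * l.+1%:R * Zi x ^+ l in
  {ae muXi, forall x, 0 < x -> Zi x < x ->
    (cond_expect x <= (marginal_premium x)%:E * expect c nu U' (payoff Psi c nu))%E} /\
  {ae muXi, forall x, 0 < x -> 0 < Zi x ->
    (cond_expect x >= (marginal_premium x)%:E * expect c nu U' (payoff Psi c nu))%E}.
Proof.
move=> muXi U' cond_expect u marginal_premium.
have clnu := proj1 nu_optimal.
have lawE A : measurable A -> distribution nu (xcoord i) A = muXi A.
  exact: closure_marginal.
have X_nu : nu.-integrable setT (EFin \o (fun w => xcoord i w ^+ k i)).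
  pose f (x : R) : \bar R := `|x ^+ k i|%:E.
  have mf : measurable_fun setT f.
    by apply/measurable_EFinP; apply: measurableT_comp => //; exact: measurable_funX.
  apply/integrableP; split.
    by apply/measurable_EFinP; exact: measurable_funX.
  rewrite -[X in (X < _)%E]/(\int[nu]_w f (xcoord i w))%E.
  rewrite -integral_distribution_measurable //.
  rewrite (_ : \int[_]_y f y = \int[muXi]_y f y)%E; last first.
    by apply: eq_measure_integral => A mA _; exact: lawE.
  rewrite /muXi !integral_distribution_measurable //; last first.
    exact: (measurableT_comp mf (measurable_component i)).
  rewrite (eq_integral (fun omega => (component i (X omega) ^+ k i)%:E)) //.
  by move=> omega _; rewrite /f /= ger0_norm // exprn_ge0 // X_ge0.
have A1' : gradient_extends_to_Delta (Psi i) \/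
    ~ exists z, {ae nu, forall w, zcoord i w = z}.
  case: A1 => [|ncst]; [by left|right=> -[z Zz]; apply: ncst; exists z].
  apply: (@ae_probability_eq1 _ _ _ nu (zcoord i @^-1` [set z])); last exact: Zz.
  by rewrite -(setTI (_ @^-1` _)); apply: (measurable_zcoord i).
have [delta delta_gt0 A2'] := A2.
have uE : u = \row_(l < k i) \int[nu]_w (zcoord i w ^+ l.+1).
  apply/rowP => l; rewrite !mxE.
  have mZl : measurable_fun setT (fun x => Zi x ^+ l.+1) by exact: measurable_funX.
  transitivity (\int[distribution nu (xcoord i)]_x (Zi x ^+ l.+1)).
    by rewrite /Rintegral; congr fine; apply: eq_measure_integral => A mA _; exact/esym/lawE.
  rewrite Rintegral_distribution //; apply: ae_eq_Rintegral.
  - exact: (measurableT_comp mZl (measurable_xcoord i)).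
  - exact: measurable_funX.
  - by apply: filterS Zi_deterministic => w ->.
rewrite /marginal_premium uE; split; apply: (ae_eq_measure lawE).
- have := stationarity_upper Psi_ge0 U_concave U_nondecreasing U_derivable U'_cont
    nu_optimal delta_gt0 A2' X_nu (Psi_cont i) Psi_i_C1 A1' Zi_measurable
    Zi_deterministic Q_law.
  by apply: filterS => x Hx _ Zx; exact: Hx.
- have := stationarity_lower Psi_ge0 U_concave U_nondecreasing U_derivable U'_cont
    nu_optimal delta_gt0 A2' X_nu (Psi_cont i) Psi_i_C1 A1' Zi_measurable
    Zi_deterministic Q_law.
  by apply: filterS => x Hx _ Zx; exact: Hx.
Qed.
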